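(* Let $(W,S)$ be a Coxeter system of finite rank (i.e. $S$ is finite). Then there is an isomorphism $$H_2(W;\mathbb{Z})\;\cong\; H_0(\mathcal{D}_{\bullet\bullet};\mathbb{Z}_2)\;\oplus\;\mathbb{Z}_2[E(\mathcal{D}_{\mathrm{even}})]\;\oplus\; H_1(\mathcal{D}_{\mathrm{odd}};\mathbb{Z}_2),$$ where in the first and last terms the diagrams are considered as 1-dimensional cell complexes. This isomorphism is natural with respect to full inclusions, i.e. it is a natural isomorphism of functors from the category of finite rank Coxeter systems and full inclusions to the category of abelian groups.
   Context: $\mathbb{Z}_n=\mathbb{Z}/n\mathbb{Z}$. A Coxeter system $(W,S)$ has $S$ finite, a symmetric matrix $m(s,t)\in\mathbb{N}\cup\{\infty\}$ ($s,t\in S$) with $m(s,t)=1$ iff $s=t$ and $m(s,t)\ge 2$ otherwise, and $W=\langle S\mid (st)^{m(s,t)}=e\rangle$ (no relation when $m(s,t)=\infty$). The following graphs are associated to $(W,S)$ ($\infty$ is neither odd nor even): - $\mathcal{D}_{\mathrm{odd}}$ has vertex set $S$, and distinct $s,t$ are joined by an edge iff $m(s,t)$ is odd. - $\mathcal{D}_{\mathrm{even}}$ has vertex set $S$, and distinct $s,t$ are joined by an edge iff $m(s,t)$ is even and $m(s,t)\ne 2$. - $\mathcal{D}_{\bullet\bullet}$ has vertex set $\{\{s,t\}\subseteq S: m(s,t)=2\}$, and two distinct vertices are joined by an edge iff they can be written as $\{s,t_1\}$ and $\{s,t_2\}$ with $m(t_1,t_2)$ odd. $E(\mathcal{D})$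 is the set of edges of $\mathcal{D}$, and $\mathbb{Z}_2[E(\mathcal{D})]$ is the $\mathbb{Z}_2$-vector space with basis $E(\mathcal{D})$. Homology of diagrams is cellular homology. A full inclusion $(U,S_U)\to(W,S_W)$ is an injection $\iota:S_U\to S_W$ with $m(\iota(s),\iota(t))=m(s,t)$ for all $s,t\in S_U$; it induces an injective group homomorphism $U\to W$, hence a map on $H_2(-;\mathbb{Z})$, and it induces inclusions of each of the three diagrams of $U$ into the corresponding diagram of $W$, hence a map on the right-hand side. *)

(* Defs.v *)
(* MathComp, with the classical axioms of boolp to decide membership in the
   relations being divided out. *)
From HB Require Import structures.
From mathcomp Require Import all_boot all_order all_algebra ring.
From mathcomp.multinomials Require Import freeg.
From mathcomp Require Import boolp.

Set Implicit Arguments.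
Unset Strict Implicit.
Unset Printing Implicit Defensive.

Import GRing.Theory.
Local Open Scope ring_scope.
Local Open Scope quotient_scope.

HB.instance Definition _ (R : nzRingType) (K : choiceType) (M : lmodType R)
    (f : K -> M) :=
  GRing.isZmodMorphism.Build {freeg K / R} M (fglift f) (lift_is_additive f).

Section FreeModule.
Variables (R : nzRingType).

Lemma eq_freeg_additive (K : choiceType) (V : zmodType)
    (f g : {additive {freeg K / R} -> V}) :
  (forall k x, f << k *g x >> = g << k *g x >>) -> f =1 g.
Proof.
by move=> fg D; rewrite -(freeg_sumE D) !raddf_sum; apply: eq_bigr => x _.
Qed.

Lemma freegZU (K : choiceType) (c k : R) (x : K) :
  c *: << k *g x >> = << c * k *g x >>.
Proof. by apply/eqP/freeg_eqP=> z; rewrite coeffZ !coeffU mulrA. Qed.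

Fact fglift_scalable (K : choiceType) (M : lmodType R) (f : K -> M) :
  scalable (fglift f).
Proof.
move=> c; pose u : {additive {freeg K / R} -> M} := fglift f \o ( *:%R c).
pose v : {additive {freeg K / R} -> M} := ( *:%R c) \o fglift f.
apply: (@eq_freeg_additive _ _ u v) => k x.
by rewrite /u /v /= freegZU !liftU scalerA.
Qed.
HB.instance Definition _ (K : choiceType) (M : lmodType R) (f : K -> M) :=
  GRing.isScalable.Build R {freeg K / R} M _ (fglift f) (fglift_scalable f).

Lemma fgliftU1 (K : choiceType) (M : lmodType R) (f : K -> M) x :
  fglift f << x >> = f x.
Proof. by rewrite liftU scale1r. Qed.

Lemma eq_freeg_linear (K : choiceType) (M : lmodType R)
    (f g : {linear {freeg K / R} -> M}) :
  (forall x, f << x >> = g << x >>) -> f =1 g.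
Proof.
move=> fg; have fgU k x : f << k *g x >> = g << k *g x >>.
  by rewrite -[k]mulr1 -freegZU !linearZ_LR fg.
exact: (@eq_freeg_additive _ _ f g).
Qed.

Definition fgpush (K L : choiceType) (f : K -> L) :
  {freeg K / R} -> {freeg L / R} := fglift (fun x => << f x >>).
HB.instance Definition _ (K L : choiceType) (f : K -> L) :=
  GRing.Linear.on (fgpush f).

Lemma fgpushU1 (K L : choiceType) (f : K -> L) x : fgpush f << x >> = << f x >>.
Proof. exact: fgliftU1. Qed.

Lemma eq_fgpush (K L : choiceType) (f g : K -> L) :
  f =1 g -> fgpush f =1 fgpush g.
Proof. by move=> fg; apply: eq_freeg_linear => x; rewrite /= !fgpushU1 fg. Qed.

Lemma fgpush_id (K : choiceType) (D : {freeg K / R}) : fgpush id D = D.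
Proof.
by move: D; apply: (@eq_freeg_linear _ _ (fgpush id) idfun) => x; apply: fgpushU1.
Qed.

Lemma fgpush_comp (K L M : choiceType) (f : L -> M) (g : K -> L) D :
  fgpush (f \o g) D = fgpush f (fgpush g D).
Proof.
move: D; apply: (@eq_freeg_linear _ _ _ (fgpush f \o fgpush g)) => x /=.
by rewrite !fgpushU1.
Qed.
End FreeModule.

(* The homology at B of A --d'--> B --d--> C.  Only the boundaries that are
   cycles are divided out, so no proof of d \o d' = 0 is carried along. *)
Section Homology.
Variables (A B C : zmodType) (d' : {additive A -> B}) (d : {additive B -> C}).

Definition is_cycle : {pred B} := fun x => d x == 0.

Fact is_cycle_zmod_closed : zmod_closed is_cycle.
Proof.
split; rewrite ?unfold_in /is_cycle ?raddf0 // => x y.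
by rewrite !unfold_in /is_cycle raddfB => /eqP-> /eqP->; rewrite subrr.
Qed.
HB.instance Definition _ := GRing.isZmodClosed.Build B is_cycle is_cycle_zmod_closed.

Record cycle_of : Type := Cycle { cycle_val :> B; _ : is_cycle cycle_val }.
HB.instance Definition _ := [isSub for cycle_val].
HB.instance Definition _ := [Choice of cycle_of by <:].
HB.instance Definition _ := [SubChoice_isSubZmodule of cycle_of by <:].

Definition is_boundary : {pred cycle_of} := fun x => `[< exists y, d' y = val x >].

Fact is_boundary_zmod_closed : zmod_closed is_boundary.
Proof.
split=> [|x y /asboolP[a ax] /asboolP[b bx]]; apply/asboolP.
  by exists 0; rewrite !raddf0.
by exists (a - b); rewrite !raddfB ax bx.
Qed.
HB.instance Definition _ :=
  GRing.isZmodClosed.Build cycle_of is_boundary is_boundary_zmod_closed.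

Definition homology := Quotient.quot is_boundary.
HB.instance Definition _ := GRing.Zmodule.on homology.
HB.instance Definition _ := EqQuotient.on homology.
End Homology.

Section HomologyPi.
Variables (A B C : zmodType) (d' : {additive A -> B}) (d : {additive B -> C}).
Local Notation H := (homology d' d).

Lemma homology_eqP (x y : cycle_of d) :
  reflect (exists a, d' a = val x - val y) (\pi_H x == \pi_H y).
Proof.
have -> : (\pi_H x == \pi_H y) = is_boundary d' (x - y).
  by have := Quotient.idealrBE (@is_boundary _ _ _ d' d) x y.
apply: (iffP (asboolP _)) => -[a]; rewrite raddfB => e; by exists a.
Qed.
End HomologyPi.

Section HomologyMap.
Variables (A B C A2 B2 C2 : zmodType).
Variables (d' : {additive A -> B}) (d : {additive B -> C}).
Variables (d2' : {additive A2 -> B2}) (d2 : {additive B2 -> C2}).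

Record chain_map := ChainMap {
  chain_hi : {additive A -> A2};
  chain_mid : {additive B -> B2};
  chain_lo : {additive C -> C2};
  chain_hiP : forall a, chain_mid (d' a) = d2' (chain_hi a);
  chain_midP : forall b, chain_lo (d b) = d2 (chain_mid b)
}.

Variable f : chain_map.

Fact cycle_map_subproof (x : cycle_of d) : is_cycle d2 (chain_mid f (val x)).
Proof.
by rewrite /is_cycle -chain_midP; have /eqP-> := valP x; rewrite raddf0.
Qed.
Definition cycle_map (x : cycle_of d) : cycle_of d2 :=
  Cycle (cycle_map_subproof x).

Definition homology_map (x : homology d' d) : homology d2' d2 :=
  \pi_(homology d2' d2) (cycle_map (repr x)).

Lemma homology_map_pi (x : cycle_of d) :
  homology_map (\pi_(homology d' d) x) =
  \pi_(homology d2' d2) (cycle_map x).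
Proof.
apply/eqP/homology_eqP.
have /eqP/homology_eqP[a ea] : repr (\pi_(homology d' d) x) = x
  %[mod homology d' d] by rewrite reprK.
by exists (chain_hi f a); rewrite -chain_hiP ea /= raddfB.
Qed.

Fact homology_map_additive : zmod_morphism homology_map.
Proof.
move=> x y; rewrite -[x]reprK -[y]reprK -[_ - _]raddfB !homology_map_pi.
rewrite -[RHS]raddfB; congr (\pi _); apply: val_inj.
by rewrite /= !raddfB.
Qed.
HB.instance Definition _ :=
  GRing.isZmodMorphism.Build _ _ homology_map homology_map_additive.
End HomologyMap.

Lemma homology_map_id (A B C : zmodType) (d' : {additive A -> B})
    (d : {additive B -> C}) (f : chain_map d' d d' d) :
  (forall b, chain_mid f b = b) -> forall x, homology_map f x = x.
Proof.
move=> f_id x; rewrite -[x]reprK homology_map_pi; congr (\pi _).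
by apply: val_inj; apply: f_id.
Qed.

Lemma homology_map_comp (A B C A2 B2 C2 A3 B3 C3 : zmodType)
    (d' : {additive A -> B}) (d : {additive B -> C})
    (d2' : {additive A2 -> B2}) (d2 : {additive B2 -> C2})
    (d3' : {additive A3 -> B3}) (d3 : {additive B3 -> C3})
    (h : chain_map d' d d3' d3) (g : chain_map d2' d2 d3' d3)
    (f : chain_map d' d d2' d2) :
  (forall b, chain_mid h b = chain_mid g (chain_mid f b)) ->
  forall x, homology_map h x = homology_map g (homology_map f x).
Proof.
move=> hgf x; rewrite -[x]reprK.
rewrite (homology_map_pi h) (homology_map_pi f) (homology_map_pi g); congr (\pi _).
by apply: val_inj; apply: hgf.
Qed.

Section GroupHomology.
Variable G : groupType.

(* Degrees 3 -> 2 -> 1 of the inhomogeneous bar complex, with trivial integer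
   coefficients. *)
Definition bar_d3 : {freeg (G * G * G)%type / int} -> {freeg (G * G)%type / int} :=
  fglift (fun x => let: (g, h, k) := x in
    << (h, k) >> - << ((g * h)%g, k) >> + << (g, (h * k)%g) >> - << (g, h) >>).
HB.instance Definition _ := GRing.Linear.on bar_d3.

Definition bar_d2 : {freeg (G * G)%type / int} -> {freeg G / int} :=
  fglift (fun x => let: (g, h) := x in << h >> - << (g * h)%g >> + << g >>).
HB.instance Definition _ := GRing.Linear.on bar_d2.

Lemma bar_d2d3 x : bar_d2 (bar_d3 x) = 0.
Proof.
move: x; apply: (@eq_freeg_linear _ _ _ (bar_d2 \o bar_d3) \0) => -[[g h] k] /=.
rewrite /bar_d3 fgliftU1 /bar_d2 !(raddfB, raddfD) /= !fgliftU1 mulgA.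
by apply/eqP/freeg_eqP=> z; rewrite !(coeffB, coeffD, coeff0); ring.
Qed.

Definition H2 := homology bar_d3 bar_d2.
HB.instance Definition _ := GRing.Zmodule.on H2.
End GroupHomology.

Section GroupHomologyMap.
Variables (G K : groupType) (f : {multiplicative G -> K}).

Definition bar_map1 : {freeg G / int} -> {freeg K / int} := fgpush f.
HB.instance Definition _ := GRing.Linear.on bar_map1.
Definition bar_map2 : {freeg (G * G)%type / int} -> {freeg (K * K)%type / int} :=
  fgpush (fun x => (f x.1, f x.2)).
HB.instance Definition _ := GRing.Linear.on bar_map2.
Definition bar_map3 :
    {freeg (G * G * G)%type / int} -> {freeg (K * K * K)%type / int} :=
  fgpush (fun x => (f x.1.1, f x.1.2, f x.2)).
HB.instance Definition _ := GRing.Linear.on bar_map3.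

Fact bar_map_d3 x : bar_map2 (bar_d3 x) = bar_d3 (bar_map3 x).
Proof.
move: x; apply: (@eq_freeg_linear _ _ _ (bar_map2 \o @bar_d3 G)
  (@bar_d3 K \o bar_map3)) => -[[g h] l] /=.
rewrite /bar_map3 fgpushU1 /bar_d3 !fgliftU1 /bar_map2.
by rewrite !(raddfB, raddfD) /= !fgpushU1 /= !gmulfM.
Qed.

Fact bar_map_d2 x : bar_map1 (bar_d2 x) = bar_d2 (bar_map2 x).
Proof.
move: x; apply: (@eq_freeg_linear _ _ _ (bar_map1 \o @bar_d2 G)
  (@bar_d2 K \o bar_map2)) => -[g h] /=.
rewrite /bar_map2 fgpushU1 /bar_d2 !fgliftU1 /bar_map1.
by rewrite !(raddfB, raddfD) /= !fgpushU1 /= !gmulfM.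
Qed.

Definition bar_map : chain_map (@bar_d3 G) (@bar_d2 G) (@bar_d3 K) (@bar_d2 K) :=
  @ChainMap _ _ _ _ _ _ _ _ _ _ bar_map3 bar_map2 bar_map1 bar_map_d3 bar_map_d2.

Definition H2_map : H2 G -> H2 K := homology_map bar_map.
HB.instance Definition _ := GRing.Additive.on H2_map.
End GroupHomologyMap.

(* The group < X | R >: words in the letters x = (x, false) and
   x^-1 = (x, true), modulo the least congruence cancelling inverse letters and
   trivializing the relators. *)
Section Presentation.
Variables (X : choiceType).
Local Notation word := (seq (X * bool)).

Inductive pres_eq (R : word -> Prop) : word -> word -> Prop :=
| pres_refl w : pres_eq R w w
| pres_sym w1 w2 : pres_eq R w1 w2 -> pres_eq R w2 w1
| pres_trans w1 w2 w3 :
    pres_eq R w1 w2 -> pres_eq R w2 w3 -> pres_eq R w1 w3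
| pres_cancel u v x b : pres_eq R (u ++ [:: (x, b); (x, ~~ b)] ++ v) (u ++ v)
| pres_relator u v r : R r -> pres_eq R (u ++ r ++ v) (u ++ v).

Variable R : word -> Prop.

Definition pres_eqb : rel word := fun w1 w2 => `[< pres_eq R w1 w2 >].

Fact pres_eqb_equiv : equiv_class_of pres_eqb.
Proof.
split=> [w|w1 w2|w2 w1 w3].
- exact/asboolP/pres_refl.
- by apply/asboolP/asboolP; apply: pres_sym.
- by move=> /asboolP w12 /asboolP w23; apply/asboolP/(pres_trans w12 w23).
Qed.
Canonical pres_eqb_equiv_rel := EquivRelPack pres_eqb_equiv.

Definition presented := {eq_quot pres_eqb}.
HB.instance Definition _ := EqQuotient.on presented.
HB.instance Definition _ := Choice.on presented.

Lemma presented_eqP (w1 w2 : word) :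
  pres_eq R w1 w2 <-> \pi_presented w1 = \pi_presented w2.
Proof.
split=> [e|/eqmodP]; last exact: asboolW.
by apply/eqmodP/asboolP.
Qed.

Lemma pres_eq_repr w : pres_eq R (repr (\pi_presented w)) w.
Proof. by apply/presented_eqP; rewrite reprK. Qed.

Lemma pres_eq_catl u w1 w2 : pres_eq R w1 w2 -> pres_eq R (u ++ w1) (u ++ w2).
Proof.
elim=> {w1 w2} [w|w1 w2 _|w1 w2 w3 _ + _|v w x b|v w r rr].
- exact: pres_refl.
- exact: pres_sym.
- exact: pres_trans.
- by rewrite !(catA u); apply: pres_cancel.
- by rewrite !(catA u); apply: pres_relator.
Qed.

Lemma pres_eq_catr u w1 w2 : pres_eq R w1 w2 -> pres_eq R (w1 ++ u) (w2 ++ u).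
Proof.
elim=> {w1 w2} [w|w1 w2 _|w1 w2 w3 _ + _|v w x b|v w r rr].
- exact: pres_refl.
- exact: pres_sym.
- exact: pres_trans.
- by rewrite -!catA; apply: pres_cancel.
- by rewrite -!catA; apply: pres_relator.
Qed.

Lemma pres_eq_cat u1 u2 w1 w2 :
  pres_eq R u1 u2 -> pres_eq R w1 w2 -> pres_eq R (u1 ++ w1) (u2 ++ w2).
Proof.
by move=> u12 w12; apply: pres_trans (pres_eq_catr _ u12) (pres_eq_catl _ w12).
Qed.

Definition inv_word (w : word) : word := rev [seq (l.1, ~~ l.2) | l <- w].

Lemma inv_wordK : involutive inv_word.
Proof.
move=> w; rewrite /inv_word map_rev revK -map_comp -[RHS]map_id.
by apply: eq_map => -[x b] /=; rewrite negbK.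
Qed.

Lemma pres_eq_mulV w : pres_eq R (w ++ inv_word w) [::].
Proof.
elim: w => [|[x b] w IHw]; first exact: pres_refl.
have -> : ((x, b) :: w) ++ inv_word ((x, b) :: w) =
    [:: (x, b)] ++ (w ++ inv_word w) ++ [:: (x, ~~ b)].
  by rewrite /inv_word /= rev_cons -cats1 catA.
rewrite catA; apply: pres_trans (pres_eq_catr _ (pres_eq_catl _ IHw)) _.
exact: (pres_cancel R [::] [::]).
Qed.

Definition pres_one : presented := \pi_presented [::].
Definition pres_mul (g h : presented) : presented := \pi_presented (repr g ++ repr h).
Definition pres_inv (g : presented) : presented := \pi_presented (inv_word (repr g)).

Lemma pres_mul_pi w1 w2 :
  pres_mul (\pi_presented w1) (\pi_presented w2) = \pi_presented (w1 ++ w2).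
Proof. by apply/presented_eqP; apply: pres_eq_cat; apply: pres_eq_repr. Qed.

Fact pres_mulA : associative pres_mul.
Proof.
move=> g h k; rewrite -[g]reprK -[h]reprK -[k]reprK.
move: (repr g) (repr h) (repr k) => u v w.
by rewrite (pres_mul_pi u v) (pres_mul_pi v w) !pres_mul_pi catA.
Qed.
Fact pres_mul1 : left_id pres_one pres_mul.
Proof. by move=> g; rewrite -[g]reprK (pres_mul_pi [::]). Qed.
Fact pres_mulr1 : right_id pres_one pres_mul.
Proof. by move=> g; rewrite -[g]reprK (pres_mul_pi _ [::]) cats0. Qed.
Fact pres_mulV : left_inverse pres_one pres_inv pres_mul.
Proof.
move=> g; rewrite -{2}[g]reprK pres_mul_pi; apply/presented_eqP.
by rewrite -{2}(inv_wordK (repr g)); apply: pres_eq_mulV.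
Qed.
Fact pres_mulVr : right_inverse pres_one pres_inv pres_mul.
Proof.
move=> g; rewrite -{1}[g]reprK pres_mul_pi; apply/presented_eqP.
exact: pres_eq_mulV.
Qed.
HB.instance Definition _ :=
  isGroup.Build presented pres_mulA pres_mul1 pres_mulr1 pres_mulV pres_mulVr.

Definition pres_gen (x : X) : presented := \pi_presented [:: (x, false)].

Section Lift.
Variables (G : groupType) (f : X -> G).
Local Open Scope group_scope.

Definition word_eval (w : word) : G :=
  \big[*%g/1]_(l <- w) (if l.2 then (f l.1)^-1 else f l.1).

Definition pres_lift (g : presented) : G := word_eval (repr g).

Lemma word_eval_cat u v : word_eval (u ++ v) = word_eval u * word_eval v.
Proof. exact: big_cat. Qed.

Hypothesis f_rel : forall r, R r -> word_eval r = 1.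

Lemma word_eval_eq w1 w2 : pres_eq R w1 w2 -> word_eval w1 = word_eval w2.
Proof.
elim=> {w1 w2} [//|//|w1 w2 w3 _ -> //|u v x b|u v r /f_rel r1].
- rewrite !word_eval_cat; congr (_ * _); rewrite -[RHS]mul1g; congr (_ * _).
  by rewrite /word_eval !big_cons big_nil mulg1; case: b; rewrite ?mulVg ?mulgV.
- by rewrite !word_eval_cat r1 mul1g.
Qed.

Lemma pres_lift_pi w : pres_lift (\pi_presented w) = word_eval w.
Proof. exact/word_eval_eq/pres_eq_repr. Qed.

Lemma pres_lift_gen x : pres_lift (pres_gen x) = f x.
Proof. by rewrite pres_lift_pi /word_eval big_cons big_nil mulg1. Qed.

Lemma pres_liftM : {morph pres_lift : g h / g * h}.
Proof.
move=> g h; rewrite -[g]reprK -[h]reprK [_ * _]pres_mul_pi !pres_lift_pi.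
exact: word_eval_cat.
Qed.
End Lift.

Lemma word_eval_gen (w : word) : word_eval pres_gen w = \pi_presented w.
Proof.
elim: w => [|[x b] w IHw]; first by rewrite /word_eval big_nil.
rewrite /word_eval big_cons -/(word_eval _ w) IHw /=.
have -> : (if b then (pres_gen x)^-1 else pres_gen x)%g = \pi_presented [:: (x, b)].
  case: b => //; apply/presented_eqP.
  have -> : [:: (x, true)] = inv_word [:: (x, false)] by [].
  set g := repr _; have eg : pres_eq R g [:: (x, false)] by apply: pres_eq_repr.
  apply: pres_trans (_ : pres_eq R (inv_word g ++ [:: (x, false); (x, true)]) _).
    rewrite -[X in pres_eq _ X]cats0; apply: pres_eq_catl; apply: pres_sym.
    exact: (pres_cancel R [::] [::] x false).
  rewrite -(cat1s (x, false)) catA -[X in pres_eq _ _ X]cat0s.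
  apply: pres_eq_catr; apply: pres_trans (pres_eq_catl _ (pres_sym eg)) _.
  by rewrite -{2}(inv_wordK g); apply: pres_eq_mulV.
by rewrite [LHS]pres_mul_pi.
Qed.
End Presentation.

(* The Coxeter matrix takes values in N u {oo}, with None for oo. *)
Record coxeter_system := CoxeterSystem {
  cox_gen : finType;
  cox_m : cox_gen -> cox_gen -> option nat;
  cox_m_sym : forall s t, cox_m s t = cox_m t s;
  cox_m_eq1 : forall s t, cox_m s t = Some 1%N <-> s = t;
  cox_m_ge2 : forall s t k, s != t -> cox_m s t = Some k -> (2 <= k)%N
}.

Definition coxeter_relator (M : coxeter_system) (r : seq (cox_gen M * bool)) :=
  exists s t k, cox_m s t = Some k /\
    r = flatten (nseq k [:: (s, false); (t, false)]).

Definition coxeter_group (M : coxeter_system) : groupType :=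
  presented (@coxeter_relator M).

Record full_inclusion (U W : coxeter_system) := FullInclusion {
  incl_fun :> cox_gen U -> cox_gen W;
  incl_inj : injective incl_fun;
  incl_m : forall s t, cox_m (incl_fun s) (incl_fun t) = cox_m s t
}.

Definition incl_id (W : coxeter_system) : full_inclusion W W :=
  @FullInclusion W W id (@inj_id _) (fun _ _ => erefl).

Definition incl_comp (U V W : coxeter_system)
    (j : full_inclusion V W) (i : full_inclusion U V) : full_inclusion U W :=
  @FullInclusion U W (j \o i) (inj_comp (@incl_inj _ _ j) (@incl_inj _ _ i))
    (fun s t => etrans (incl_m j (i s) (i t)) (incl_m i s t)).

Section CoxeterMap.
Variables (U W : coxeter_system) (i : full_inclusion U W).
Local Open Scope group_scope.

Definition coxeter_map : coxeter_group U -> coxeter_group W :=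
  pres_lift (fun s => pres_gen (@coxeter_relator W) (i s)).

Lemma word_eval_incl (w : seq (cox_gen U * bool)) :
  word_eval (fun s => pres_gen (@coxeter_relator W) (i s)) w =
    \pi_(presented (@coxeter_relator W)) [seq (i l.1, l.2) | l <- w].
Proof. by rewrite -word_eval_gen /word_eval big_map. Qed.

Fact coxeter_map_relator r : coxeter_relator r ->
  word_eval (fun s => pres_gen (@coxeter_relator W) (i s)) r = 1.
Proof.
case=> [s [t [k [stk ->]]]]; rewrite word_eval_incl; apply/presented_eqP.
rewrite -[X in pres_eq _ X]cats0; apply: (pres_relator [::]).
exists (i s), (i t), k; split; first by rewrite incl_m.
by rewrite map_flatten map_nseq.
Qed.

Lemma coxeter_map_gen s : coxeter_map (pres_gen _ s) = pres_gen _ (i s).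
Proof. exact: pres_lift_gen coxeter_map_relator s. Qed.

Fact coxeter_mapM : {morph coxeter_map : g h / g * h}.
Proof. exact: pres_liftM coxeter_map_relator. Qed.
HB.instance Definition _ :=
  isMultiplicative.Build (coxeter_group U) (coxeter_group W) coxeter_map coxeter_mapM.
End CoxeterMap.

Record graph := Graph {
  vert : finType;
  adj : rel vert;
  adj_sym : symmetric adj;
  adj_irr : irreflexive adj
}.

Record graph_inclusion (D E : graph) := GraphInclusion {
  ginc_fun :> vert D -> vert E;
  ginc_inj : injective ginc_fun;
  ginc_adj : forall x y, adj x y -> adj (ginc_fun x) (ginc_fun y)
}.

Section Edges.
Variable D : graph.

Definition is_edge (A : {set vert D}) : bool :=
  [exists x, exists y, adj x y && (A == [set x; y])].

Definition edge := {A : {set vert D} | is_edge A}.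
HB.instance Definition _ := SubFinite.on edge.
End Edges.

(* The cellular chain complex of a graph with coefficients in Z_2; signs being
   irrelevant, the boundary of an edge is the sum of its two endpoints.  The
   zero groups on either side are the chains on the empty set of cells. *)
Section GraphHomology.
Variable D : graph.

Definition graph_d1 : {freeg (edge D) / 'Z_2} -> {freeg (vert D) / 'Z_2} :=
  fglift (fun e : edge D => \sum_(x in val e) << x >>).
HB.instance Definition _ := GRing.Linear.on graph_d1.

Definition graph_H0 :=
  homology graph_d1 (\0 : {freeg (vert D) / 'Z_2} -> {freeg void / 'Z_2}).
HB.instance Definition _ := GRing.Zmodule.on graph_H0.

Definition graph_H1 :=
  homology (\0 : {freeg void / 'Z_2} -> {freeg (edge D) / 'Z_2}) graph_d1.
HB.instance Definition _ := GRing.Zmodule.on graph_H1.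
End GraphHomology.

Section GraphHomologyMap.
Variables (D E : graph) (f : graph_inclusion D E).

Fact edge_map_subproof (e : edge D) : is_edge (f @: val e).
Proof.
have /existsP[x /existsP[y /andP[xy /eqP->]]] := valP e.
apply/existsP; exists (f x); apply/existsP; exists (f y).
by rewrite (ginc_adj f xy) imsetU !imset_set1 eqxx.
Qed.
Definition edge_map (e : edge D) : edge E := Sub _ (edge_map_subproof e).

Definition graph_map0 : {freeg (vert D) / 'Z_2} -> {freeg (vert E) / 'Z_2} :=
  fgpush f.
HB.instance Definition _ := GRing.Linear.on graph_map0.

Definition graph_map1 : {freeg (edge D) / 'Z_2} -> {freeg (edge E) / 'Z_2} :=
  fgpush edge_map.
HB.instance Definition _ := GRing.Linear.on graph_map1.

Fact graph_map_d1 x : graph_map0 (graph_d1 x) = graph_d1 (graph_map1 x).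
Proof.
move: x; apply: (@eq_freeg_linear _ _ _ (graph_map0 \o @graph_d1 D)
  (@graph_d1 E \o graph_map1)) => e /=.
rewrite /graph_map1 fgpushU1 /graph_d1 !fgliftU1 raddf_sum /=.
rewrite big_imset /=; last by move=> x y _ _; apply: ginc_inj.
by apply: eq_bigr => x _; rewrite /graph_map0 fgpushU1.
Qed.

Fact graph_H0_map_subproof x :
  (\0 : {freeg void / 'Z_2} -> {freeg void / 'Z_2})
    ((\0 : {freeg (vert D) / 'Z_2} -> {freeg void / 'Z_2}) x) =
  (\0 : {freeg (vert E) / 'Z_2} -> {freeg void / 'Z_2}) (graph_map0 x).
Proof. by []. Qed.

Fact graph_H1_map_subproof x :
  graph_map1 ((\0 : {freeg void / 'Z_2} -> {freeg (edge D) / 'Z_2}) x) =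
  (\0 : {freeg void / 'Z_2} -> {freeg (edge E) / 'Z_2})
    ((\0 : {freeg void / 'Z_2} -> {freeg void / 'Z_2}) x).
Proof. exact: raddf0. Qed.

Definition graph_H0_map : graph_H0 D -> graph_H0 E :=
  homology_map (@ChainMap _ _ _ _ _ _ _ _ _ _ graph_map1 graph_map0 \0
    graph_map_d1 graph_H0_map_subproof).
HB.instance Definition _ := GRing.Additive.on graph_H0_map.

Definition graph_H1_map : graph_H1 D -> graph_H1 E :=
  homology_map (@ChainMap _ _ _ _ _ _ _ _ _ _ \0 graph_map1 graph_map0
    graph_H1_map_subproof graph_map_d1).
HB.instance Definition _ := GRing.Additive.on graph_H1_map.
End GraphHomologyMap.

Definition odd_label (l : option nat) : bool := if l is Some k then odd k else false.
Definition even_label (l : option nat) : bool :=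
  if l is Some k then ~~ odd k else false.

Section Diagrams.
Variable M : coxeter_system.
Local Notation S := (cox_gen M).

Definition odd_adj : rel S := fun s t => (s != t) && odd_label (cox_m s t).
Fact odd_adj_sym : symmetric odd_adj.
Proof. by move=> s t; rewrite /odd_adj eq_sym cox_m_sym. Qed.
Fact odd_adj_irr : irreflexive odd_adj.
Proof. by move=> s; rewrite /odd_adj eqxx. Qed.
Definition D_odd : graph := Graph odd_adj_sym odd_adj_irr.

Definition even_adj : rel S := fun s t =>
  [&& s != t, even_label (cox_m s t) & cox_m s t != Some 2%N].
Fact even_adj_sym : symmetric even_adj.
Proof. by move=> s t; rewrite /even_adj eq_sym cox_m_sym. Qed.
Fact even_adj_irr : irreflexive even_adj.
Proof. by move=> s; rewrite /even_adj eqxx. Qed.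
Definition D_even : graph := Graph even_adj_sym even_adj_irr.

Definition is_commuting_pair (A : {set S}) : bool :=
  [exists s, exists t, (cox_m s t == Some 2%N) && (A == [set s; t])].
Definition commuting_pair := {A : {set S} | is_commuting_pair A}.
HB.instance Definition _ := SubFinite.on commuting_pair.

Definition bullet_adj : rel commuting_pair := fun A B =>
  (A != B) && [exists s, exists t1, exists t2,
    [&& val A == [set s; t1], val B == [set s; t2] & odd_label (cox_m t1 t2)]].
Fact bullet_adj_sym : symmetric bullet_adj.
Proof.
suff sub A B : bullet_adj A B -> bullet_adj B A by move=> A B; apply/idP/idP; apply: sub.
case/andP=> AB /existsP[s /existsP[t1 /existsP[t2 /and3P[At Bt odd12]]]].
rewrite /bullet_adj eq_sym AB; apply/existsP; exists s; apply/existsP; exists t2.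
by apply/existsP; exists t1; rewrite At Bt cox_m_sym.
Qed.
Fact bullet_adj_irr : irreflexive bullet_adj.
Proof. by move=> A; rewrite /bullet_adj eqxx. Qed.
Definition D_bullet : graph := Graph bullet_adj_sym bullet_adj_irr.
End Diagrams.

Section DiagramMaps.
Variables (U W : coxeter_system) (i : full_inclusion U W).

Fact incl_odd_adj (s t : cox_gen U) : odd_adj s t -> odd_adj (i s) (i t).
Proof. by rewrite /odd_adj incl_m (inj_eq (@incl_inj _ _ i)). Qed.
Definition D_odd_incl : graph_inclusion (D_odd U) (D_odd W) :=
  @GraphInclusion (D_odd U) (D_odd W) i (@incl_inj _ _ i) incl_odd_adj.

Fact incl_even_adj (s t : cox_gen U) : even_adj s t -> even_adj (i s) (i t).
Proof. by rewrite /even_adj incl_m (inj_eq (@incl_inj _ _ i)). Qed.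
Definition D_even_incl : graph_inclusion (D_even U) (D_even W) :=
  @GraphInclusion (D_even U) (D_even W) i (@incl_inj _ _ i) incl_even_adj.

Fact pair_map_subproof (A : commuting_pair U) : is_commuting_pair (i @: val A).
Proof.
have /existsP[s /existsP[t /andP[st /eqP->]]] := valP A.
apply/existsP; exists (i s); apply/existsP; exists (i t).
by rewrite incl_m st imsetU !imset_set1 eqxx.
Qed.
Definition pair_map (A : commuting_pair U) : commuting_pair W :=
  Sub _ (pair_map_subproof A).

Fact pair_map_inj : injective pair_map.
Proof.
by move=> A B [AB]; apply/val_inj/(imset_inj (@incl_inj _ _ i)).
Qed.

Fact pair_map_adj (A B : commuting_pair U) :
  bullet_adj A B -> bullet_adj (pair_map A) (pair_map B).
Proof.
case/andP=> AB /existsP[s /existsP[t1 /existsP[t2 /and3P[/eqP At /eqP Bt odd12]]]].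
rewrite /bullet_adj (inj_eq pair_map_inj) AB; apply/existsP; exists (i s).
apply/existsP; exists (i t1); apply/existsP; exists (i t2).
by rewrite incl_m odd12 /= At Bt !imsetU !imset_set1 !eqxx.
Qed.
Definition D_bullet_incl : graph_inclusion (D_bullet U) (D_bullet W) :=
  @GraphInclusion (D_bullet U) (D_bullet W) pair_map pair_map_inj pair_map_adj.
End DiagramMaps.

Definition cox_H2 (W : coxeter_system) : zmodType := H2 (coxeter_group W).

Definition cox_H2_map (U W : coxeter_system) (i : full_inclusion U W) :
  cox_H2 U -> cox_H2 W := H2_map (coxeter_map i).
HB.instance Definition _ (U W : coxeter_system) (i : full_inclusion U W) :=
  GRing.Additive.on (cox_H2_map i).

Definition diagram_sum (W : coxeter_system) : zmodType :=
  (graph_H0 (D_bullet W) * {freeg (edge (D_even W)) / 'Z_2}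
    * graph_H1 (D_odd W))%type.

Definition diagram_sum_map (U W : coxeter_system) (i : full_inclusion U W)
    (x : diagram_sum U) : diagram_sum W :=
  (graph_H0_map (D_bullet_incl i) x.1.1,
   graph_map1 (D_even_incl i) x.1.2,
   graph_H1_map (D_odd_incl i) x.2).

Fact diagram_sum_map_additive (U W : coxeter_system) (i : full_inclusion U W) :
  zmod_morphism (diagram_sum_map i).
Proof. by move=> x y; rewrite /diagram_sum_map /= !raddfB. Qed.
HB.instance Definition _ (U W : coxeter_system) (i : full_inclusion U W) :=
  GRing.isZmodMorphism.Build (diagram_sum U) (diagram_sum W) (diagram_sum_map i)
    (diagram_sum_map_additive i).

Section Functoriality.
Variables (U V W : coxeter_system).
Variables (i : full_inclusion U V) (j : full_inclusion V W).

Lemma coxeter_map_id g : coxeter_map (incl_id W) g = g.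
Proof.
rewrite -[RHS]reprK /coxeter_map /pres_lift word_eval_incl.
by congr (\pi _); rewrite -[RHS]map_id; apply: eq_map => -[].
Qed.

Lemma coxeter_map_comp g :
  coxeter_map (incl_comp j i) g = coxeter_map j (coxeter_map i g).
Proof.
rewrite /coxeter_map {1 3}/pres_lift !word_eval_incl.
rewrite (pres_lift_pi (@coxeter_map_relator _ _ j)) word_eval_incl.
by rewrite -map_comp.
Qed.

Lemma cox_H2_map_id x : cox_H2_map (incl_id W) x = x.
Proof.
apply: homology_map_id => b; rewrite /= -[RHS]fgpush_id.
by apply: eq_fgpush => -[g h]; rewrite /= !coxeter_map_id.
Qed.

Lemma cox_H2_map_comp x :
  cox_H2_map (incl_comp j i) x = cox_H2_map j (cox_H2_map i x).
Proof.
apply: homology_map_comp => b; rewrite /= /bar_map2 -fgpush_comp.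
by apply: eq_fgpush => -[g h]; rewrite /= !coxeter_map_comp.
Qed.

Lemma diagram_sum_map_id x : diagram_sum_map (incl_id W) x = x.
Proof.
case: x => [[x y] z]; rewrite /diagram_sum_map /=; congr (_, _, _).
- apply: homology_map_id => b; rewrite /= -[RHS]fgpush_id.
  by apply: eq_fgpush => A; apply: val_inj; rewrite /= imset_id.
- rewrite -[RHS]fgpush_id.
  by apply: eq_fgpush => A; apply: val_inj; rewrite /= imset_id.
- apply: homology_map_id => b; rewrite /= -[RHS]fgpush_id.
  by apply: eq_fgpush => A; apply: val_inj; rewrite /= imset_id.
Qed.

Lemma diagram_sum_map_comp x :
  diagram_sum_map (incl_comp j i) x = diagram_sum_map j (diagram_sum_map i x).
Proof.
case: x => [[x y] z]; rewrite /diagram_sum_map /=; congr (_, _, _).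
- apply: homology_map_comp => b; rewrite /= /graph_map0 -fgpush_comp.
  by apply: eq_fgpush => A; apply: val_inj; rewrite /= imset_comp.
- rewrite /graph_map1 -fgpush_comp.
  by apply: eq_fgpush => A; apply: val_inj; rewrite /= imset_comp.
- apply: homology_map_comp => b; rewrite /= /graph_map1 -fgpush_comp.
  by apply: eq_fgpush => A; apply: val_inj; rewrite /= imset_comp.
Qed.
End Functoriality.

(* Main.v *)
Require Import Defs.
From HB Require Import structures.
From mathcomp Require Import all_boot all_order all_algebra all_field ring zify.
From mathcomp.multinomials Require Import freeg.
From mathcomp Require Import boolp.

(** Let M = C_2(W) / B_2 be the group of bar 2-chains of W modulo boundaries.  Then
    H_2(W) is the kernel of the boundary map of M, and the tautological 2-cocycle
    (g, h) |-> [g|h] makes W x M a central extension E of W by M.  Lift each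
    generator s to s' = (s, 0).  The squares s'^2 and the powers (s' t')^m(s,t) lie
    in M; write a_s for the former and c_st for the latter minus m/2 (rounded down)
    times a_s + a_t ([sq_class] and [rel_class]).

    Relations.  Central squares make the subgroup of s' and t' almost dihedral, and
    this gives c_st = c_ts, while 2 c_st is a_s + a_t for odd m and 0 for even m.
    If m(s,t) = 2 then c_st is a commutator of s' and t', which is insensitive to
    central factors; so c_st1 = c_st2 when s commutes with t1 and t2 and m(t1,t2) is
    odd, as t1 and t2 are then conjugate by an element commuting with s.

    Generation.  Modulo the subgroup spanned by the a_s and c_st the lifts s' satisfy
    the Coxeter relations, so E splits and the tautological cocycle becomes a
    coboundary, which vanishes on cycles.  Hence every element of H_2(W) is an
    integral combination of the a_s and c_st ([bar_class_lattice]).  The boundary of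
    a_s is 2[s], that of c_st is [s] + [t] for odd m and 0 for even m: a combination
    is a cycle if and only if its coefficients at the odd edges reduce modulo two to
    a cycle of the odd diagram and those at the a_s have the then unique value.
    By the relations it vanishes as soon as its coefficients modulo two vanish at the
    even and odd edges and sum up to a boundary on the diagram of commuting pairs
    ([lattice_class_eq0]).

    Independence.  The converse needs functionals M -> Z/2 with prescribed values on
    the c_st.  An action of W up to a central involution yields one: it vanishes on
    the a_s and its value at c_st tells whether (st)^m acts as the involution
    ([twisted_functional]).  Two families of such actions suffice.
    - In a Clifford algebra take unit vectors e_s such that e_s e_t has eigenvalues
      x and 1/x, with x a primitive root of unity of order m or 2m: then (e_s e_t)^m
      is 1 or -1.  For m > 2 both choices are open, for m = 2 only the second one, and
      differences of the resulting functionals isolate the single edges with m > 2.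
    - On W x X let s act by (w, y) |-> (s w, x_g y) with g = w^-1 s w, where the
      operators x_g on X are involutions that commute up to a sign.  Around a
      dihedral polygon the same operators are met twice in the same order, whence a
      sign which does not depend on w; for m(s,t) = 2 it is the one by which x_s and
      x_t commute.  Choose the sign for x_g and x_h to be -1 exactly when g and h are
      simultaneously conjugate to a commuting pair of generators from a given
      component of the diagram of commuting pairs.  These actions separate the
      components, because commuting pairs of generators that are conjugate in W lie
      in the same component ([commuting_conj_connect]).  That is proved with reduced
      words: the second construction, with commuting operators, gives the deletion
      condition, hence minimal coset representatives for parabolic subgroups, and a
      conjugation is cut into steps inside parabolic subgroups of rank three.

    So H_2(W) and the diagram side are quotients, by the same subgroup, of the same
    subgroup of a free abelian group; the quotient maps are natural, and so is the
    resulting isomorphism. *)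

Set Implicit Arguments.
Unset Strict Implicit.
Unset Printing Implicit Defensive.

Import GRing.Theory Num.Theory.
Local Open Scope ring_scope.
Local Open Scope quotient_scope.

(** * Set, graph and group lemmas *)

Lemma iter_addb (T : Type) (z : T -> T) (a b : bool) : involutive z ->
  forall x, iter (a (+) b) z x = iter a z (iter b z x).
Proof. by move=> zK x; case: a; case: b; rewrite //= zK. Qed.

Lemma eq_set2 (T : finType) (a b c d : T) : a != b -> [set a; b] = [set c; d] ->
  (c = a /\ d = b) \/ (c = b /\ d = a).
Proof.
move=> ab /setP e.
have := e a; have := e b; have := e c; have := e d.
rewrite !inE !eqxx !orbT => /pred2P hd /pred2P hc hb ha.
case: hd hb ha => ->; case: hc => -> hb ha; [|by right|by left|].
  by rewrite !(eq_sym b) (negPf ab) in hb.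
by rewrite !(negPf ab) in ha.
Qed.

Lemma connect_first (T : finType) (e : rel T) x y :
  connect e x y -> x != y -> exists z, e x z.
Proof.
case/connectP=> -[|z p] /= => [_ ->|/andP[xz _] _ _]; first by rewrite eqxx.
by exists z.
Qed.

Lemma expg_sandwich (G : groupType) (c k : G) n :
  (c * (k * c) = k -> c ^+ n * (k * c ^+ n) = k)%g.
Proof.
move=> ckc; elim: n => [|n IHn]; first by rewrite expg0 mul1g mulg1.
by rewrite {1}expgSr expgS -mulgA (mulgA k) (mulgA c) ckc.
Qed.

(** * Free abelian groups and reduction modulo two *)

Section ReductionModTwo.
Variable K : choiceType.

Definition red2 : {freeg K / int} -> {freeg K / 'Z_2} :=
  @fglift int (zmodule {freeg K / 'Z_2}) K (fun x => << x >>).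

Fact red2_additive : zmod_morphism red2.
Proof. exact: (@lift_is_additive int K (zmodule {freeg K / 'Z_2})). Qed.
HB.instance Definition _ :=
  GRing.isZmodMorphism.Build {freeg K / int} {freeg K / 'Z_2} red2 red2_additive.

Lemma red2U k x : red2 << k *g x >> = << k%:~R *g x >>.
Proof. by rewrite /red2 liftU scalezrE freegU_mulz. Qed.

Lemma coeff_red2 x D : coeff x (red2 D) = (coeff x D)%:~R.
Proof.
pose f : {freeg K / int} -> 'Z_2 := coeff x \o red2.
pose g : {freeg K / int} -> 'Z_2 := intmul 1 \o coeff x.
apply: (@eq_freeg_additive int K 'Z_2 f g) => k y.
by rewrite /= red2U !coeffU; case: eqP; rewrite ?mulr1 ?mulr0.
Qed.

Lemma Z2_double (x : 'Z_2) : x + x = 0.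
Proof. by apply/val_inj; case: x => [[|[|[]]]]. Qed.

Lemma freeg2_double (D : {freeg K / 'Z_2}) : D + D = 0.
Proof. by apply/eqP/freeg_eqP => x; rewrite coeffD coeff0 Z2_double. Qed.

Lemma natr_Z2_eq0 (n : nat) : (n%:R == 0 :> 'Z_2) = ~~ odd n.
Proof. by rewrite -val_eqE /= val_Zp_nat // modn2; case: odd. Qed.

Lemma intr_Z2_eq0 (k : int) : (k%:~R == 0 :> 'Z_2) -> exists j, k = j + j.
Proof.
case: (intP k) => [_|n|n]; first by exists 0; rewrite addr0.
  by rewrite -pmulrn natr_Z2_eq0 => h; exists (n.+1./2)%:Z; lia.
rewrite mulrNz oppr_eq0 -pmulrn natr_Z2_eq0 => h.
by exists (- (n.+1./2)%:Z); lia.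
Qed.

Lemma red2_eq0 D : red2 D = 0 -> exists D', D = D' + D'.
Proof.
move=> D0; exists (\sum_(x <- dom D) << ((coeff x D) %/ 2)%Z *g x >>).
rewrite -big_split /= -[LHS]freeg_sumE; apply: eq_bigr => x _.
rewrite freegUD; congr [freeg [:: (_, _)]].
have: (coeff x D)%:~R == 0 :> 'Z_2 by rewrite -coeff_red2 D0 coeff0.
by case/intr_Z2_eq0 => j ->; lia.
Qed.

Lemma red2_surj D : exists D', red2 D' = D.
Proof.
exists (\sum_(x <- dom D) << (nat_of_ord (coeff x D))%:Z *g x >>).
rewrite raddf_sum /= -[RHS]freeg_sumE; apply: eq_bigr => x _.
by rewrite red2U -pmulrn natr_Zp.
Qed.
End ReductionModTwo.

Lemma red2_push (K L : choiceType) (f : K -> L) D :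
  red2 (fgpush f D) = fgpush f (red2 D).
Proof.
pose u : {freeg K / int} -> {freeg L / 'Z_2} := red2 (K:=L) \o fgpush f.
pose v : {freeg K / int} -> {freeg L / 'Z_2} := fgpush f \o red2 (K:=K).
apply: (@eq_freeg_additive int K {freeg L / 'Z_2} u v) => k x.
rewrite /= /fgpush liftU freegZU mulr1 !red2U.
by rewrite liftU freegZU mulr1.
Qed.

Section IntegralExtension.
Variables (K : choiceType) (A : zmodType) (f : K -> A).

(** The alias [zmodule] carries the integer scaling which [fglift] needs and which
    an arbitrary abelian group does not have as a structure. *)
Definition zlift : {freeg K / int} -> A := @fglift int (zmodule A) K f.

Fact zlift_additive : zmod_morphism zlift.
Proof. exact: (@lift_is_additive int K (zmodule A)). Qed.
HB.instance Definition _ :=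
  GRing.isZmodMorphism.Build {freeg K / int} A zlift zlift_additive.

Lemma zliftU x : zlift << x >> = f x.
Proof. by rewrite /zlift liftU scale1r. Qed.
End IntegralExtension.

Lemma eq_freegZ (K : choiceType) (A : zmodType)
    (f g : {additive {freeg K / int} -> A}) :
  (forall x, f << x >> = g << x >>) -> f =1 g.
Proof.
move=> fg; apply: eq_freeg_additive => k x.
by rewrite -[k]intz -freegU_mulz !raddfMz fg.
Qed.

Section IntegralExtensionTheory.
Variables (K : choiceType) (A : zmodType).

Lemma eq_zlift (f g : K -> A) : f =1 g -> zlift f =1 zlift g.
Proof. by move=> fg; apply: eq_freegZ => x; rewrite /= !zliftU fg. Qed.

Lemma zlift0 D : zlift (fun _ : K => 0 : A) D = 0.
Proof. by move: D; apply: (eq_freegZ (g := \0)) => x; rewrite /= zliftU. Qed.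

Lemma zliftD (f g : K -> A) D : zlift (fun x => f x + g x) D = zlift f D + zlift g D.
Proof.
rewrite -(freeg_sumE D) !raddf_sum -big_split /=; apply: eq_bigr => x _.
by rewrite -[coeff x D]intz -freegU_mulz !raddfMz -mulrzDl /= !zliftU.
Qed.

Lemma zlift_comp (B : zmodType) (h : {additive A -> B}) (f : K -> A) D :
  h (zlift f D) = zlift (h \o f) D.
Proof.
move: D; apply: (eq_freegZ (f := h \o zlift f)) => x.
by rewrite /= !zliftU.
Qed.

Lemma zlift_push (L : choiceType) (f : L -> A) (g : K -> L) D :
  zlift f (fgpush g D) = zlift (f \o g) D.
Proof.
move: D; apply: (eq_freegZ (f := zlift f \o fgpush g)) => x.
by rewrite /= fgpushU1 !zliftU.
Qed.
End IntegralExtensionTheory.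

Lemma fgpushE (K L : choiceType) (f : K -> L) (D : {freeg K / int}) :
  fgpush f D = zlift (fun x => << f x >>) D.
Proof.
by move: D; apply: (eq_freegZ (f := fgpush f)) => x; rewrite /= fgpushU1 zliftU.
Qed.

Lemma zlift_double (K : choiceType) (A : zmodType) (f : K -> A) D :
  (forall x, f x + f x = 0) -> zlift f (D + D) = 0.
Proof.
by move=> f2; rewrite raddfD -zliftD (eq_zlift (g := fun=> 0)) ?zlift0.
Qed.

Lemma zlift_red2 (K : choiceType) (f : K -> 'Z_2) (D : {freeg K / int}) :
  red2 D = 0 -> zlift f D = 0.
Proof.
by case/red2_eq0=> D' ->; apply: zlift_double => x; apply: Z2_double.
Qed.

Section AdditiveCorrespondence.
Variables (L H D M N : zmodType).
Variables (Th : {additive L -> M}) (j : {additive H -> M}).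
Variables (Q : {additive L -> N}) (J : {additive D -> N}).
Hypotheses (j_inj : injective j) (J_inj : injective J).
Hypothesis total : forall h, exists x d, Th x = j h /\ Q x = J d.
Hypothesis onto : forall d, exists x h, Th x = j h /\ Q x = J d.
Hypothesis ker1 : forall x, Th x = 0 -> Q x = 0.
Hypothesis ker2 : forall x h, Th x = j h -> Q x = 0 -> Th x = 0.

(** H and D are compared through the elements of L that have a counterpart in both: the
    two maps from these elements are onto and have the same kernel. *)
Lemma additive_correspondence : exists phi : {additive H -> D},
  bijective phi /\ forall x h, Th x = j h -> Q x = J (phi h).
Proof.
pose x h := projT1 (cid (total h)).
have xP h : exists d, Th (x h) = j h /\ Q (x h) = J d := projT2 (cid (total h)).
pose f h := projT1 (cid (xP h)).
have fP h : Th (x h) = j h /\ Q (x h) = J (f h) := projT2 (cid (xP h)).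
have uniq_f y h : Th y = j h -> Q y = J (f h).
  move=> yh; have [xh <-] := fP h; apply/eqP; rewrite -subr_eq0 -raddfB.
  by apply/eqP/ker1; rewrite raddfB /= yh xh subrr.
have fA : zmod_morphism f.
  move=> g h; apply: J_inj; rewrite raddfB -!(proj2 (fP _)) -raddfB.
  rewrite (proj2 (fP (g - h))); apply/esym/uniq_f.
  by rewrite raddfB /= !(proj1 (fP _)) raddfB.
pose fadd := GRing.isZmodMorphism.Build H D f fA.
pose F : {additive H -> D} := HB.pack f fadd.
exists F; split; last exact: uniq_f.
have f_inj : injective f.
  move=> g h gh; apply/eqP; rewrite -subr_eq0; apply/eqP/j_inj.
  have [e1 e2] := fP (g - h); rewrite raddf0 -e1; apply: (ker2 e1).
  by rewrite e2 fA gh subrr raddf0.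
have r_ex d : exists h x, Th x = j h /\ Q x = J d.
  by have [y [h p]] := onto d; exists h, y.
pose r d := projT1 (cid (r_ex d)).
have rP d : exists x, Th x = j (r d) /\ Q x = J d := projT2 (cid (r_ex d)).
exists r => [h|d].
  have [y [yr yh]] := rP (f h); apply: f_inj; apply: J_inj.
  by rewrite -(uniq_f _ _ yr).
have [y [yr yd]] := rP d; apply: J_inj.
by rewrite -yd; apply/esym/uniq_f.
Qed.
End AdditiveCorrespondence.

(** * Homology of graphs *)

Section GraphComponents.
Variable D : graph.
Local Notation V := (vert D).

Fact adj_is_edge (x y : V) : adj x y -> is_edge [set x; y].
Proof.
by move=> xy; apply/existsP; exists x; apply/existsP; exists y; rewrite xy eqxx.
Qed.

Lemma graph_d1_edge (e : edge D) (x y : V) :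
  x != y -> val e = [set x; y] -> graph_d1 << e >> = << x >> + << y >>.
Proof.
move=> xy exy; have ->: graph_d1 << e >> = \sum_(z in val e) << z >>.
  exact: fgliftU1.
by rewrite exy big_setU1 ?inE // big_set1.
Qed.

(** Modulo two the edges of a path have telescoping boundaries. *)
Lemma connect_boundary (x y : V) : connect (@adj D) x y ->
  exists w : {freeg (edge D) / 'Z_2}, graph_d1 w = << x >> + << y >>.
Proof.
case/connectP=> p; elim: p x => [|z p IHp] x /=.
  by move=> _ ->; exists 0; rewrite raddf0 freeg2_double.
case/andP=> xz pz ly; have [w dw] := IHp z pz ly.
exists (<< Sub _ (adj_is_edge xz) : edge D >> + w).
have xDz: x != z by apply: contraTneq xz => ->; rewrite adj_irr.
rewrite raddfD /= dw (graph_d1_edge xDz) //.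
by rewrite addrA -(addrA << x >>) freeg2_double addr0.
Qed.

Definition component_sum (v : V) : {freeg V / 'Z_2} -> 'Z_2 :=
  @fglift 'Z_2 ('Z_2)^o V (fun x => (connect (@adj D) v x)%:R).
HB.instance Definition _ (v : V) :=
  GRing.isZmodMorphism.Build {freeg V / 'Z_2} 'Z_2 (component_sum v)
    (@lift_is_additive 'Z_2 V ('Z_2)^o _).

Lemma component_sumU v k x :
  component_sum v << k *g x >> = k * (connect (@adj D) v x)%:R.
Proof. by rewrite /component_sum liftU. Qed.

(** Moving every vertex to the root of its component changes a chain by a boundary,
    and the coefficient which arrives at a root is the sum over its component. *)
Lemma boundary_of_component_sums (x : {freeg V / 'Z_2}) :
  (forall v, component_sum v x = 0) -> exists w, graph_d1 w = x.
Proof.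
move=> x0; have csym: connect_sym (@adj D) by apply: sym_connect_sym (@adj_sym D).
pose r : {freeg V / 'Z_2} -> {freeg V / 'Z_2} := fgpush (fingraph.root (@adj D)).
have r0: r x = 0.
  apply/eqP/freeg_eqP => v; rewrite coeff0.
  have [rv|nrv] := boolP (fingraph.root (@adj D) v == v).
    rewrite -(x0 v); move: x {x0}.
    apply: (@eq_freeg_additive 'Z_2 V 'Z_2 (coeff v \o r) (component_sum v)) => k y.
    rewrite /= /r /fgpush liftU freegZU mulr1 coeffU component_sumU; congr (_ * _%:R).
    by rewrite -(eqP rv) (eqP rv) -(root_connect csym) (eqP rv) eq_sym.
  move: x {x0}; apply: (@eq_freeg_additive 'Z_2 V 'Z_2 (coeff v \o r) \0) => k y.
  rewrite /= /r /fgpush liftU freegZU mulr1 coeffU.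
  case: eqP => [ry|]; last by rewrite mulr0.
  by case/eqP: nrv; rewrite -ry (root_root csym).
suff [w dw]: exists w, graph_d1 w = x + r x.
  by exists w; rewrite dw r0; exact: addr0.
rewrite -(freeg_sumE x); elim: (dom x) => [|y s [w dw]].
  by exists 0; rewrite !big_nil /r !raddf0 addr0.
have [w' dw'] := connect_boundary (connect_root (@adj D) y).
exists (coeff y x *: w' + w); rewrite raddfD /= dw linearZ_LR /= dw' !big_cons.
rewrite scalerDr addrACA /r; congr (_ + _); first by rewrite freegZU mulr1.
by rewrite [RHS]raddfD /=; congr (_ + _); rewrite /fgpush liftU.
Qed.
End GraphComponents.

Section GraphHomologyAccess.
Variable D : graph.
Local Notation C0 := {freeg (vert D) / 'Z_2}.
Local Notation C1 := {freeg (edge D) / 'Z_2}.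
Local Notation d0 := (\0 : C0 -> {freeg void / 'Z_2}).
Local Notation d2 := (\0 : {freeg void / 'Z_2} -> C1).

Definition H0_class (x : C0) : graph_H0 D :=
  \pi_(homology (@graph_d1 D) d0) (@Cycle _ _ d0 x (eqxx 0)).

Fact H0_class_additive : zmod_morphism H0_class.
Proof.
by move=> x y; rewrite /H0_class -raddfB; congr (\pi _); apply: val_inj.
Qed.
HB.instance Definition _ :=
  GRing.isZmodMorphism.Build C0 (graph_H0 D) H0_class H0_class_additive.

Lemma H0_class_eq0 x : H0_class x = 0 <-> exists w, graph_d1 w = x.
Proof.
rewrite -(raddf0 H0_class); split=> [/eqP/homology_eqP[w /= e]|[w e]].
  by exists w; rewrite e subr0.
by apply/eqP/homology_eqP; exists w; rewrite /= subr0.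
Qed.

Lemma H0_class_surj h : exists x, H0_class x = h.
Proof.
by exists (val (repr h)); rewrite -[RHS]reprK; congr (\pi _); apply: val_inj.
Qed.

(** Nothing is divided out in degree one, so a homology class is determined by
    any cycle that represents it. *)
Definition H1_chain (h : graph_H1 D) : C1 := val (repr h).

Lemma H1_chainE (z : cycle_of (@graph_d1 D)) :
  H1_chain (\pi_(homology d2 (@graph_d1 D)) z) = val z.
Proof.
rewrite /H1_chain; set y := repr _.
have /eqP/homology_eqP[a /= e] :
    \pi_(homology d2 (@graph_d1 D)) y = \pi_(homology d2 (@graph_d1 D)) z.
  by rewrite reprK.
by apply/eqP; rewrite -subr_eq0 -e.
Qed.

Fact H1_chain_additive : zmod_morphism H1_chain.
Proof.
move=> x y; rewrite -[x]reprK -[y]reprK -[_ - _]raddfB !H1_chainE.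
by rewrite raddfB.
Qed.
HB.instance Definition _ :=
  GRing.isZmodMorphism.Build (graph_H1 D) C1 H1_chain H1_chain_additive.

Lemma H1_chain_inj : injective H1_chain.
Proof.
move=> x y; rewrite -[x]reprK -[y]reprK !H1_chainE => e.
by congr (\pi _); apply: val_inj.
Qed.

Lemma H1_chain_d1 h : graph_d1 (H1_chain h) = 0.
Proof. by apply/eqP; exact: (valP (repr h)). Qed.

Lemma H1_chain_surj z : graph_d1 z = 0 -> exists h, H1_chain h = z.
Proof.
move=> /eqP dz; exists (\pi_(homology d2 (@graph_d1 D)) (Cycle dz)).
by rewrite H1_chainE.
Qed.
End GraphHomologyAccess.

Section GraphHomologyAccessMap.
Variables (D E : graph) (f : graph_inclusion D E).

Lemma H0_class_map x : graph_H0_map f (H0_class x) = H0_class (graph_map0 f x).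
Proof.
by rewrite /graph_H0_map homology_map_pi; congr (\pi _); apply: val_inj.
Qed.

Lemma H1_chain_map h : H1_chain (graph_H1_map f h) = graph_map1 f (H1_chain h).
Proof.
by rewrite -[h]reprK /graph_H1_map homology_map_pi !H1_chainE.
Qed.
End GraphHomologyAccessMap.

(** * Central extensions and the bar complex *)

Section CentralKernel.
Local Open Scope group_scope.

Lemma dihedral_power_sym (G : groupType) (x y : G) (m : nat) :
  (forall g, commute ((x * y) ^+ m) g) -> (y * x) ^+ m = (x * y) ^+ m.
Proof.
move=> c; have <-: ((x * y) ^+ m) ^ x = (x * y) ^+ m.
  by rewrite conjgE (c x) mulKg.
by rewrite conjXg conjgE !mulgA mulVg mul1g.
Qed.

(** Both (x y)(y x) and (y x)(x y) equal the central element x^2 y^2, and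
    (y x)^m = (x y)^m as the latter is central. *)
Lemma dihedral_power_sq (G : groupType) (x y : G) (m : nat) :
    (forall g, commute (x * x) g) -> (forall g, commute (y * y) g) ->
    (forall g, commute ((x * y) ^+ m) g) ->
  (x * y) ^+ m * (x * y) ^+ m = (x * x * (y * y)) ^+ m.
Proof.
move=> cx cy cxy; rewrite -{2}(dihedral_power_sym cxy).
have e1: x * y * (y * x) = x * x * (y * y).
  by rewrite -mulgA (mulgA y) (cy x) !mulgA.
have e2: y * x * (x * y) = x * x * (y * y).
  by rewrite !mulgA -(mulgA y) -(cx y) -mulgA.
rewrite -e1 [RHS]expgMn // /commute e1 e2 //.
Qed.

Variables (E W : groupType) (p : UMagmaMorphism.type E W).
Hypothesis kerC : forall e : E, p e = 1 -> forall g, commute e g.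

Lemma commg_ker_central (x y : E) : commute (p x) (p y) ->
  forall g, commute [~ x, y] g.
Proof. by move=> c; apply: kerC; rewrite gmulfR; apply/eqP/commgP. Qed.

(** This turns the relator of two commuting generators into a commutator. *)
Lemma commute_square (x y : E) : commute (p x) (p y) ->
  (x * y) ^+ 2 = x * x * (y * y) * [~ y, x].
Proof.
move=> c; have yC := commg_ker_central (commute_sym c) y.
by rewrite expg2 -mulgA (mulgA y x y) (commgC y x) -(mulgA _ _ y) yC !mulgA.
Qed.

(** A commutator of elements whose images commute only depends on these images,
    and conjugation by u fixes s modulo the kernel while it moves x to y.  The
    classes of adjacent commuting pairs are identified in this way. *)
Lemma commg_conj_central (s x y u : E) :
    p x ^ p u = p y -> commute (p x) (p s) -> commute (p u) (p s) ->
  [~ x, s] = [~ y, s].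
Proof.
move=> xu cx cu; have su: p s ^ p u = p s by rewrite conjgE -cu mulKg.
have cy: commute (p y) (p s) by rewrite -xu -su /commute -!conjMg cx.
have eqC (a b c d : E) : p a = p c -> p b = p d -> [~ a, b] = [~ c, d].
  suff l (a1 b1 c1 : E) : p a1 = p c1 -> [~ a1, b1] = [~ c1, b1].
    move=> pac pbd; rewrite (l _ _ _ pac).
    by rewrite -(invgR b c) (l _ _ _ pbd) invgR.
  move=> pac; have z1: p (a1 / c1) = 1 by rewrite gmulfF pac mulgV.
  rewrite -(mulgVK c1 a1) !commgEl conjMg (conjgE (a1 / c1)) (kerC z1 b1) mulKg.
  by rewrite invgM -mulgA mulKg.
rewrite -(eqC (x ^ u) s y s _ erefl) ?gmulfJ //.
transitivity ([~ x, s] ^ u).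
  by rewrite conjgE (commg_ker_central cx u) mulKg.
by rewrite conjRg; apply: eqC => //; rewrite gmulfJ conjgE -cu mulKg.
Qed.
End CentralKernel.

Section DihedralConjugate.
Local Open Scope group_scope.
(** For odd m the rotation x y has the square root (x y)^((m + 1) / 2), and the
    conjugate of the reflection x by a rotation u is x u^2. *)
Lemma odd_dihedral_conj (G : groupType) (x y : G) (m : nat) :
  x * x = 1 -> y * y = 1 -> odd m -> (x * y) ^+ m = 1 ->
  x ^ ((x * y) ^+ (uphalf m)) = y.
Proof.
move=> x2 y2 om xym; set u := _ ^+ uphalf m.
have uu : u * u = x * y.
  rewrite /u -expgnDr addnn uphalf_half om add1n.
  have -> : (m./2.+1).*2 = m.+1 by lia.
  by rewrite expgS xym mulg1.
have ux: u ^ x = u^-1.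
  rewrite /u conjXg conjgE !mulgA mulVg mul1g -expVgn invgM.
  by rewrite (mulg1_eq x2) (mulg1_eq y2).
rewrite conjgE -ux conjgE !mulgA -(mulgA _ x x) x2 mulg1 -(mulgA _ u) uu.
by rewrite !mulgA mulVg mul1g.
Qed.
End DihedralConjugate.

Section LiftModuloCentral.
Variables (X : choiceType) (R : seq (X * bool) -> Prop).
Variables (G : groupType) (f : X -> G) (Z : G -> Prop).
Local Open Scope group_scope.
Hypothesis Z1 : Z 1.
Hypothesis ZM : forall g h, Z g -> Z h -> Z (g * h).
Hypothesis ZV : forall g, Z g -> Z g^-1.
Hypothesis Zcentral : forall z, Z z -> forall g, commute z g.
Hypothesis f_rel : forall r, R r -> Z (word_eval f r).

(** When the relators evaluate into a central subgroup, evaluation of words still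
    descends to the presented group modulo this subgroup. *)
Lemma word_eval_eq_central w1 w2 : pres_eq R w1 w2 ->
  exists2 z, Z z & word_eval f w1 = word_eval f w2 * z.
Proof.
elim=> {w1 w2}
  [w|w1 w2 _ [z Zz e]|w1 w2 w3 _ [z Zz ->] _ [z' Zz' ->]|u v x b|u v r Rr].
- by exists 1; rewrite ?mulg1.
- by exists z^-1; [exact: ZV|rewrite e mulgK].
- by exists (z' * z); [exact: ZM|rewrite mulgA].
- exists 1; rewrite ?mulg1 // !word_eval_cat; congr (_ * _); rewrite -[RHS]mul1g.
  congr (_ * _); rewrite /word_eval !big_cons big_nil mulg1.
  by case: b; rewrite ?mulVg ?mulgV.
- exists (word_eval f r); first exact: f_rel.
  by rewrite !word_eval_cat (Zcentral (f_rel Rr)) mulgA.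
Qed.
End LiftModuloCentral.

Lemma word_eval_morph (X : choiceType) (G H : groupType) (p : UMagmaMorphism.type G H)
    (f : X -> G) w : p (word_eval f w) = word_eval (p \o f) w.
Proof.
rewrite /word_eval gmulf_prod; apply: eq_bigr => -[x b] _ /=.
by case: b; rewrite //= gmulfV.
Qed.

Section CocycleExtension.
Variables (G : groupType) (M : zmodType).

Record cocycle := Cocycle {
  cocycle_fun :> G -> G -> M;
  cocycleP : forall g h k,
    cocycle_fun h k + cocycle_fun g (h * k)%g =
    cocycle_fun (g * h)%g k + cocycle_fun g h
}.

Definition cocycle_ext (c : cocycle) : Type := (G * M)%type.
HB.instance Definition _ c := Choice.on (cocycle_ext c).

Variable c : cocycle.

Lemma cocycle1g g : c 1%g g = c 1%g 1%g.
Proof. by have := cocycleP c 1%g 1%g g; rewrite !mul1g => /addrI. Qed.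

Lemma cocycleg1 g : c g 1%g = c 1%g 1%g.
Proof. by have := cocycleP c g 1%g 1%g; rewrite mulg1 mulg1 => /addIr. Qed.

Lemma cocycleVg g : c g^-1%g g = c g g^-1%g.
Proof.
have := cocycleP c g g^-1%g g; rewrite mulVg mulgV cocycle1g cocycleg1.
by rewrite addrC => /addrI.
Qed.

Local Notation E := (cocycle_ext c).

Definition ext_mul (e f : E) : E :=
  ((e.1 * f.1)%g, e.2 + f.2 + c e.1 f.1).
Definition ext_one : E := (1%g, - c 1%g 1%g).
Definition ext_inv (e : E) : E :=
  (e.1^-1%g, - e.2 - c e.1 e.1^-1%g - c 1%g 1%g).

Fact ext_mulA : associative ext_mul.
Proof.
move=> [g x] [h y] [k z]; rewrite /ext_mul /= mulgA; congr (_, _).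
rewrite !addrA -(addrA (x + y + z)) (cocycleP c) addrA.
by rewrite (addrAC (x + y) (c g h)) addrAC.
Qed.
Fact ext_mul1 : left_id ext_one ext_mul.
Proof.
by move=> [g x]; rewrite /ext_mul /= mul1g cocycle1g addrAC addNr add0r.
Qed.
Fact ext_mulr1 : right_id ext_one ext_mul.
Proof. by move=> [g x]; rewrite /ext_mul /= mulg1 cocycleg1 subrK. Qed.
Fact ext_mulV : left_inverse ext_one ext_inv ext_mul.
Proof.
move=> [g x]; rewrite /ext_mul /ext_one /= mulVg cocycleVg; congr (_, _).
by rewrite addrAC (addrAC _ _ (c g _)) subrK addrAC addNr add0r.
Qed.
Fact ext_mulVr : right_inverse ext_one ext_inv ext_mul.
Proof.
move=> [g x]; rewrite /ext_mul /ext_one /= mulgV; congr (_, _).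
by rewrite !addrA subrr add0r addrAC addNr add0r.
Qed.
HB.instance Definition _ :=
  isGroup.Build E ext_mulA ext_mul1 ext_mulr1 ext_mulV ext_mulVr.

Lemma ext_mulE (e f : E) :
  (e * f)%g = ((e.1 * f.1)%g, e.2 + f.2 + c e.1 f.1) :> E.
Proof. by []. Qed.

Definition ext_proj (e : E) : G := e.1.
Fact ext_projM : {morph ext_proj : e f / (e * f)%g}.
Proof. by []. Qed.
HB.instance Definition _ := isMultiplicative.Build E G ext_proj ext_projM.
HB.instance Definition _ :=
  Multiplicative_isUMagmaMorphism.Build E G ext_proj erefl.

(** The cocycle is not normalized: the unit is (1, - c(1, 1)), which shifts the
    identification of the fibre over 1 with M. *)
Definition ext_in (x : M) : E := (1%g, x - c 1%g 1%g).
Definition ext_val (e : E) : M := e.2 + c 1%g 1%g.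

Lemma ext_inK x : ext_val (ext_in x) = x.
Proof. by rewrite /ext_val /= subrK. Qed.

Lemma ext_valK e : ext_proj e = 1%g -> ext_in (ext_val e) = e.
Proof. by case: e => g x /= ->; rewrite /ext_in /ext_val /= addrK. Qed.

Lemma ext_inD x y : ext_in (x + y) = (ext_in x * ext_in y)%g.
Proof.
rewrite ext_mulE /= mulg1; congr (_, _).
by rewrite addrA subrK addrAC.
Qed.

Lemma ext_in0 : ext_in 0 = 1%g.
Proof. by rewrite /ext_in sub0r. Qed.

Lemma ext_inMn x n : ext_in (x *+ n) = (ext_in x ^+ n)%g.
Proof. by elim: n => [|n IHn]; rewrite ?ext_in0 // mulrS expgS ext_inD IHn. Qed.

Lemma ext_ker_central (e : E) : ext_proj e = 1%g ->
  forall f, commute e f.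
Proof.
case: e => g x /= -> [h y]; rewrite /commute !ext_mulE /= mul1g mulg1.
by rewrite cocycle1g cocycleg1 (addrC x).
Qed.

Lemma ext_inV x : ext_in (- x) = (ext_in x)^-1%g.
Proof. by apply/esym/mulg1_eq; rewrite -ext_inD subrr ext_in0. Qed.
End CocycleExtension.

Section BarCokernel.
Variable G : groupType.
Local Notation C2 := {freeg (G * G)%type / int}.
Local Notation C1 := {freeg G / int}.

(** All 2-chains are kept, not only cycles: this is the universal coefficient group
    for 2-cocycles, and homology is the kernel of [coker_d2] on it. *)
Definition bar_coker := homology (@bar_d3 G) (\0 : C2 -> C1).
HB.instance Definition _ := GRing.Zmodule.on bar_coker.

Definition bar_class (z : C2) : bar_coker :=
  \pi_(homology (@bar_d3 G) (\0 : C2 -> C1))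
    (@Cycle _ _ (\0 : C2 -> C1) z (eqxx 0)).
Fact bar_class_additive : zmod_morphism bar_class.
Proof.
by move=> x y; rewrite /bar_class -raddfB; congr (\pi _); apply: val_inj.
Qed.
HB.instance Definition _ :=
  GRing.isZmodMorphism.Build C2 bar_coker bar_class bar_class_additive.

Lemma bar_class_eqP x y : bar_class x = bar_class y <-> exists a, bar_d3 a = x - y.
Proof.
by split=> [/eqP/homology_eqP|h]; last exact/eqP/homology_eqP.
Qed.

Lemma bar_class_d3 a : bar_class (bar_d3 a) = 0.
Proof.
by rewrite -(raddf0 bar_class); apply/bar_class_eqP; exists a; rewrite subr0.
Qed.

Lemma bar_classP (x : bar_coker) : exists z, x = bar_class z.
Proof.
exists (val (repr x)); rewrite -[LHS]reprK; congr (\pi _); exact: val_inj.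
Qed.

Lemma bar_classW (P : bar_coker -> Prop) :
  (forall z, P (bar_class z)) -> forall x, P x.
Proof. by move=> Pz x; have [z ->] := bar_classP x. Qed.

Section Lift.
Variables (A : zmodType) (h : {additive C2 -> A}).
Hypothesis hd3 : forall a, h (bar_d3 a) = 0.

Definition coker_lift (x : bar_coker) : A := h (val (repr x)).

Lemma coker_liftE z : coker_lift (bar_class z) = h z.
Proof.
rewrite /coker_lift; apply/eqP; rewrite -subr_eq0 -raddfB /=.
have /bar_class_eqP[a <-]: bar_class (val (repr (bar_class z))) = bar_class z.
  by rewrite -[RHS]reprK; congr (\pi _); exact: val_inj.
by rewrite hd3.
Qed.

Fact coker_lift_additive : zmod_morphism coker_lift.
Proof.
move=> x y; elim/bar_classW: x => x; elim/bar_classW: y => y.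
by rewrite -[_ - _](raddfB bar_class) !coker_liftE raddfB.
Qed.
End Lift.

Definition coker_d2 : bar_coker -> C1 := coker_lift (@bar_d2 G).
HB.instance Definition _ :=
  GRing.isZmodMorphism.Build bar_coker C1 coker_d2
    (coker_lift_additive (@bar_d2d3 G)).

Lemma coker_d2E z : coker_d2 (bar_class z) = bar_d2 z.
Proof. exact: coker_liftE (@bar_d2d3 G) z. Qed.

Definition H2_coker (x : H2 G) : bar_coker := bar_class (val (repr x)).

Lemma H2_cokerE (z : cycle_of (@bar_d2 G)) :
  H2_coker (\pi_(homology (@bar_d3 G) (@bar_d2 G)) z) = bar_class (val z).
Proof.
rewrite /H2_coker; apply/bar_class_eqP.
by apply/(homology_eqP (@bar_d3 G)); rewrite reprK.
Qed.

Fact H2_coker_additive : zmod_morphism H2_coker.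
Proof.
move=> x y; rewrite -[x]reprK -[y]reprK -[_ - _]raddfB !H2_cokerE.
by rewrite -raddfB.
Qed.
HB.instance Definition _ :=
  GRing.isZmodMorphism.Build (H2 G) bar_coker H2_coker H2_coker_additive.

Lemma H2_coker_inj : injective H2_coker.
Proof.
move=> x y; rewrite -[x]reprK -[y]reprK !H2_cokerE => /bar_class_eqP h.
exact/eqP/homology_eqP.
Qed.

Lemma H2_coker_d2 x : coker_d2 (H2_coker x) = 0.
Proof.
by rewrite -[x]reprK H2_cokerE coker_d2E; apply/eqP; exact: (valP (repr x)).
Qed.

Lemma H2_coker_image x : coker_d2 x = 0 -> exists y, H2_coker y = x.
Proof.
elim/bar_classW: x => z; rewrite coker_d2E => /eqP z0.
by exists (\pi_(homology _ _) (Cycle z0)); rewrite H2_cokerE.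
Qed.

Definition bar_cocycle_fun (g h : G) : bar_coker := bar_class << (g, h) >>.
Fact bar_cocycleP g h k :
  bar_cocycle_fun h k + bar_cocycle_fun g (h * k)%g =
  bar_cocycle_fun (g * h)%g k + bar_cocycle_fun g h.
Proof.
have := bar_class_d3 << (g, h, k) >>.
rewrite /bar_d3 fgliftU1 raddfB raddfD raddfB /= -!/(bar_cocycle_fun _ _) => /eqP.
by rewrite subr_eq0 addrAC subr_eq => /eqP ->; rewrite addrC.
Qed.
Definition bar_cocycle : cocycle G bar_coker := Cocycle bar_cocycleP.
End BarCokernel.

(** * Functionals from projective actions *)

Section CentralInvolution.
Variables (G : groupType) (z : G).
Local Open Scope group_scope.
Hypothesis z2 : z * z = 1.

Lemma expg_Z2D (a b : 'Z_2) : z ^+ (a + b)%R = z ^+ a * z ^+ b.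
Proof.
by case: a b => [[|[|//]] ?] [[|[|//]] ?]; rewrite /= ?expg0 ?mul1g ?mulg1.
Qed.

Hypothesis z1 : z != 1.

Lemma expg_Z2_inj (a b : 'Z_2) : z ^+ a = z ^+ b -> a = b.
Proof.
case: a b => [[|[|//]] ?] [[|[|//]] ?] /= e; apply/val_inj => //=.
  by case/eqP: z1; rewrite -[LHS]expg1 -e.
by case/eqP: z1; rewrite -[LHS]expg1 e.
Qed.
End CentralInvolution.

Definition ext_gen (X : choiceType) (R : seq (X * bool) -> Prop) (x : X) :
  cocycle_ext (bar_cocycle (presented R)) := (pres_gen R x, 0%R).

Section CentralLift.
Variables (X : choiceType) (R : seq (X * bool) -> Prop).
Local Notation P := (presented R).
Variables (G : groupType) (e : X -> G) (z : G).
Local Open Scope group_scope.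
Hypothesis z2 : z * z = 1.
Hypothesis z1 : z != 1.
Hypothesis zC : forall g, commute z g.
Hypothesis e_rel : forall r, R r -> exists b : bool, word_eval e r = z ^+ b.
Hypothesis gen_inj : injective (pres_gen R).

Let rep (g : P) : seq (X * bool) :=
  match pselect (exists x, g = pres_gen R x) with
  | left h => [:: (projT1 (cid h), false)]
  | right _ => repr g
  end.

Let pi_rep g : \pi_P (rep g) = g.
Proof.
rewrite /rep; case: pselect => [h|_]; last exact: reprK.
by case: cid => x /= ->.
Qed.

Let s (g : P) : G := word_eval e (rep g).

Let s_gen x : s (pres_gen R x) = e x.
Proof.
rewrite /s /rep; case: pselect => [h|[]]; last by exists x.
by case: cid => y /= /gen_inj <-; rewrite /word_eval big_cons big_nil mulg1.
Qed.

Let word_eval_pi w1 w2 : \pi_P w1 = \pi_P w2 ->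
  exists b : 'Z_2, word_eval e w1 = word_eval e w2 * z ^+ b.
Proof.
move=> /presented_eqP w12.
have [g [b ->] ->] : exists2 g, (exists b : 'Z_2, g = z ^+ b)
    & word_eval e w1 = word_eval e w2 * g; last by exists b.
apply: (word_eval_eq_central _ _ _ _ _ w12).
- by exists 0%R.
- by move=> _ _ [a ->] [b ->]; exists (a + b)%R; rewrite expg_Z2D.
- by move=> _ [a ->]; exists (- a)%R; apply: mulg1_eq; rewrite -expg_Z2D // subrr.
- by move=> _ [b ->] g; apply/commute_sym/commuteX/commute_sym.
- by move=> r /e_rel[b ->]; exists (b%:R)%R; case: b.
Qed.

Let f_ex g h : exists b : 'Z_2, s g * s h = s (g * h) * z ^+ b.
Proof.
rewrite /s -word_eval_cat; apply: word_eval_pi.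
by rewrite pi_rep -pres_mul_pi !pi_rep.
Qed.
Let f (g h : P) : 'Z_2 := projT1 (cid (f_ex g h)).
Let fE g h : s g * s h = s (g * h) * z ^+ f g h.
Proof. exact: (projT2 (cid (f_ex g h))). Qed.

Let zXC (a : 'Z_2) g : commute (z ^+ a) g.
Proof. exact/commute_sym/commuteX/commute_sym. Qed.

Let f_cocycle g h k : (f h k + f g (h * k)%g = f (g * h)%g k + f g h)%R.
Proof.
apply: (expg_Z2_inj z1); rewrite !expg_Z2D //; apply: (mulgI (s (g * h * k))).
rewrite (zXC (f h k)) -{1}(mulgA g).
transitivity (s g * (s h * s k)); first by rewrite (fE h k) [RHS]mulgA (fE g) -mulgA.
by rewrite mulgA (fE g h) -mulgA (zXC (f g h)) mulgA (fE (g * h)) -mulgA.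
Qed.

Let v2 : {freeg (P * P)%type / int} -> 'Z_2 := zlift (fun p => f p.1 p.2).

Let v2_d3 a : v2 (bar_d3 a) = 0%R.
Proof.
move: a; apply: (eq_freegZ (f := v2 \o @bar_d3 P) (g := \0%R)) => -[[g h] k] /=.
rewrite /bar_d3 fgliftU1 /v2 raddfB raddfD raddfB /= !zliftU /=.
have /eqP := f_cocycle g h k.
by rewrite addrAC -subr_eq0 opprD addrACA addrA addrAC => /eqP.
Qed.

Let v : bar_coker P -> 'Z_2 := coker_lift v2.
HB.instance Definition _ :=
  GRing.isZmodMorphism.Build (bar_coker P) 'Z_2 v (coker_lift_additive v2_d3).

Let Phi (x : cocycle_ext (bar_cocycle P)) : G := s x.1 * z ^+ v x.2.
Let PhiM : {morph Phi : x y / x * y}.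
Proof.
move=> [g x] [h y]; rewrite /Phi ext_mulE.
change (s (g * h) * z ^+ v (x + y + bar_cocycle_fun g h)%R =
  s g * z ^+ v x * (s h * z ^+ v y)).
have -> : v (x + y + bar_cocycle_fun g h)%R = (f g h + (v x + v y))%R.
  rewrite addrC !raddfD; congr (_ + _)%R.
  have -> : f g h = v2 << (g, h) >> by rewrite /v2 zliftU.
  exact: (coker_liftE v2_d3).
rewrite !expg_Z2D // mulgA -fE -!mulgA; congr (_ * _).
by rewrite !mulgA (zXC (v x)).
Qed.
Let Phi1 : Phi 1 = 1.
Proof. by apply: (mulgI (Phi 1)); rewrite -PhiM !mulg1. Qed.
HB.instance Definition _ := isMultiplicative.Build _ G Phi PhiM.
HB.instance Definition _ := Multiplicative_isUMagmaMorphism.Build _ G Phi Phi1.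

(** A section s of the projective lift has a cocycle with values in Z/2, which extends
    to a functional v of 2-chains modulo boundaries; then (g, x) |-> s(g) z^v(x) is
    a homomorphism on the tautological extension.  The section is made to agree
    with the given lifts on generators, which are therefore required to be distinct. *)
Lemma central_lift_functional :
  exists (v : {additive bar_coker P -> 'Z_2})
    (Phi : UMagmaMorphism.type (cocycle_ext (bar_cocycle P)) G),
  (forall x, Phi (ext_gen R x) = e x) /\
  (forall m, Phi (ext_in _ m) = z ^+ v m).
Proof.
exists v, Phi; split=> [x|m].
  by rewrite /= /Phi s_gen [v _]raddf0 mulg1.
have h : Phi (ext_in (bar_cocycle P) m) = Phi (ext_in (bar_cocycle P) 0) * z ^+ v m.
  rewrite /Phi -!mulgA; congr (_ * _); rewrite -expg_Z2D //; congr (_ ^+ nat_of_ord _).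
  by rewrite /= sub0r addrC raddfD.
by rewrite [LHS]h ext_in0 Phi1 mul1g.
Qed.
End CentralLift.

Section EquivariantPermutations.
Variables (T : Type) (z : T -> T).

(** Commuting with z is imposed so that z is central in the resulting group. *)
Record eqperm := EqPerm {
  eqperm_fun :> T -> T;
  eqperm_inv : T -> T;
  eqperm_funK : cancel eqperm_fun eqperm_inv;
  eqperm_invK : cancel eqperm_inv eqperm_fun;
  eqpermC : forall x, eqperm_fun (z x) = z (eqperm_fun x)
}.
HB.instance Definition _ := gen_eqMixin eqperm.
HB.instance Definition _ := gen_choiceMixin eqperm.

Lemma eqpermP (f g : eqperm) : eqperm_fun f =1 g -> f = g.
Proof.
case: f g => f f' fK f'K fz [g g' gK g'K gz] /= /funext fg; subst g.
have e : f' = g' by apply/funext => x; rewrite -[x in RHS]f'K gK.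
by subst g'; congr EqPerm; apply: Prop_irrelevance.
Qed.

Fact eqperm_invC (f : eqperm) x : eqperm_inv f (z x) = z (eqperm_inv f x).
Proof. by apply: (can_inj (@eqperm_funK f)); rewrite eqpermC !eqperm_invK. Qed.
Definition eqperm_one : eqperm :=
  @EqPerm id id (fun=> erefl) (fun=> erefl) (fun=> erefl).
Definition eqperm_opp (f : eqperm) : eqperm :=
  EqPerm (@eqperm_invK f) (@eqperm_funK f) (@eqperm_invC f).
Fact eqperm_mulC (f g : eqperm) x : (f \o g) (z x) = z ((f \o g) x).
Proof. by rewrite /= !eqpermC. Qed.
Definition eqperm_mul (f g : eqperm) : eqperm :=
  EqPerm (can_comp (@eqperm_funK f) (@eqperm_funK g))
         (can_comp (@eqperm_invK g) (@eqperm_invK f)) (@eqperm_mulC f g).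
Fact eqperm_mulA : associative eqperm_mul.
Proof. by move=> f g h; apply: eqpermP. Qed.
Fact eqperm_mul1 : left_id eqperm_one eqperm_mul.
Proof. by move=> f; apply: eqpermP. Qed.
Fact eqperm_mulr1 : right_id eqperm_one eqperm_mul.
Proof. by move=> f; apply: eqpermP. Qed.
Fact eqperm_mulV : left_inverse eqperm_one eqperm_opp eqperm_mul.
Proof. by move=> f; apply: eqpermP => x; rewrite /= eqperm_funK. Qed.
Fact eqperm_mulVr : right_inverse eqperm_one eqperm_opp eqperm_mul.
Proof. by move=> f; apply: eqpermP => x; rewrite /= eqperm_invK. Qed.
HB.instance Definition _ :=
  isGroup.Build eqperm eqperm_mulA eqperm_mul1 eqperm_mulr1 eqperm_mulV eqperm_mulVr.

Lemma eqperm_mulE (f g : eqperm) x : (f * g)%g x = f (g x).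
Proof. by []. Qed.

Lemma eqperm_expgE (f : eqperm) n x : (f ^+ n)%g x = iter n f x.
Proof. by elim: n x => [|n IHn] x //=; rewrite expgS eqperm_mulE IHn. Qed.

Definition eqperm_involution (f : T -> T) (fK : involutive f)
  (fz : forall x, f (z x) = z (f x)) : eqperm := EqPerm fK fK fz.
End EquivariantPermutations.

(** An action of W up to the involution [tw_flip], given by lifts of the generators:
    [tw_sign] tells which dihedral relations hold only up to this involution. *)
Record twisted_action (W : coxeter_system) := TwistedAction {
  tw_space : Type;
  tw_flip : tw_space -> tw_space;
  tw_gen : cox_gen W -> tw_space -> tw_space;
  tw_sign : cox_gen W -> cox_gen W -> bool;
  tw_flipK : involutive tw_flip;
  tw_genK : forall s, involutive (tw_gen s);
  tw_genC : forall s x, tw_gen s (tw_flip x) = tw_flip (tw_gen s x);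
  tw_rel : forall s t k, s != t -> cox_m s t = Some k -> forall x,
    iter k (tw_gen s \o tw_gen t) x = iter (tw_sign s t) tw_flip x
}.

Lemma word_eval_alternating (X : choiceType) (G : groupType) (f : X -> G) s t k :
  word_eval f (flatten (nseq k [:: (s, false); (t, false)])) = ((f s * f t) ^+ k)%g.
Proof.
elim: k => [|k IHk]; first by rewrite /word_eval big_nil.
rewrite /= -[_ :: _ :: _]/([:: _; _] ++ _) word_eval_cat IHk expgS; congr (_ * _)%g.
by rewrite /word_eval !big_cons big_nil mulg1.
Qed.

Lemma cox_m_diag (W : coxeter_system) (s : cox_gen W) : cox_m s s = Some 1%N.
Proof. by apply/cox_m_eq1. Qed.

Section TwistedAction.
Variables (W : coxeter_system) (A : twisted_action W).
Local Notation T := (tw_space A).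
Local Notation z := (@tw_flip _ A).
Local Notation G := (eqperm z).

Definition tw_perm (s : cox_gen W) : G :=
  eqperm_involution (@tw_genK _ A s) (@tw_genC _ A s).
Definition tw_center : G := eqperm_involution (@tw_flipK _ A) (fun=> erefl).

Lemma tw_center2 : (tw_center * tw_center = 1)%g.
Proof. by apply: eqpermP => x; rewrite eqperm_mulE /= tw_flipK. Qed.

Lemma tw_center_central (g : G) : commute tw_center g.
Proof. by apply: eqpermP => x; rewrite !eqperm_mulE /= eqpermC. Qed.

Lemma tw_perm2 s : (tw_perm s * tw_perm s = 1)%g.
Proof. by apply: eqpermP => x; rewrite eqperm_mulE /= tw_genK. Qed.

Lemma tw_perm_power s t k : s != t -> cox_m s t = Some k ->
  ((tw_perm s * tw_perm t) ^+ k = tw_center ^+ tw_sign A s t)%g.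
Proof.
move=> st mst; apply: eqpermP => x; rewrite !eqperm_expgE.
exact: (tw_rel st mst x).
Qed.

Lemma tw_perm_relator r : coxeter_relator r ->
  exists b : bool, word_eval tw_perm r = (tw_center ^+ b)%g.
Proof.
case=> s [t [k [mst ->]]]; rewrite word_eval_alternating.
have [st|st] := eqVneq s t; last by exists (tw_sign A s t); apply: tw_perm_power.
exists false; move: mst; rewrite st cox_m_diag => -[<-].
by rewrite expg1 tw_perm2.
Qed.

Lemma tw_word_eval w1 w2 : pres_eq (@coxeter_relator W) w1 w2 ->
  exists b : bool, forall x, word_eval tw_perm w1 x = iter b z (word_eval tw_perm w2 x).
Proof.
move=> w12; have [g [b ->] ->] : exists2 g, (exists b : bool, g = tw_center ^+ b)%g
    & (word_eval tw_perm w1 = word_eval tw_perm w2 * g)%g.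
  apply: (word_eval_eq_central _ _ _ _ _ w12).
  - by exists false.
  - by move=> _ _ [[] ->] [[] ->];
      [exists false|exists true|exists true|exists false];
      rewrite /= ?expg1 ?expg0 ?tw_center2 ?mulg1 ?mul1g.
  - move=> _ [b ->]; exists b; apply: mulg1_eq.
    by case: b; rewrite /= ?expg1 ?tw_center2 ?mulg1.
  - by move=> _ [b ->] g; apply/commute_sym/commuteX/commute_sym/tw_center_central.
  - by move=> r /tw_perm_relator[b ->]; exists b.
exists b => x; rewrite eqperm_mulE eqperm_expgE.
by case: b => //=; rewrite eqpermC.
Qed.
End TwistedAction.

(** * The Clifford action *)

Section CliffordOperators.
Variable I : finType.
Local Notation bits := {ffun I -> bool}.
Definition clifford_module : lmodType algC := {ffun bits -> algC^o}.
Local Notation V := clifford_module.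

Definition bits_add (p q : bits) : bits := [ffun i => p i (+) q i].
Definition bits_above (i : I) : bits := [ffun j => (enum_rank i < enum_rank j)%N].

Lemma bits_addAC p q r : bits_add (bits_add p q) r = bits_add (bits_add p r) q.
Proof. by apply/ffunP => i; rewrite !ffunE addbAC. Qed.

Lemma bits_addK p q : bits_add (bits_add p q) q = p.
Proof. by apply/ffunP => i; rewrite !ffunE -addbA addbb addbF. Qed.

(** The Clifford element with coordinates v.  The basis element at i multiplies by the
    sign of bit i and flips the bits above i; as exactly one of i < j and j < i holds,
    distinct basis elements anticommute, and each of them squares to one. *)
Definition clifford (v : I -> algC) (F : V) : V :=
  [ffun p : bits => \sum_i v i * (-1) ^+ p i * F (bits_add p (bits_above i))].

Fact clifford_linear v : linear (clifford v).
Proof.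
move=> a F H; apply/ffunP => p; rewrite !ffunE scaler_sumr -big_split.
by apply: eq_bigr => i _ /=; rewrite !ffunE /GRing.scale /=; ring.
Qed.
HB.instance Definition _ v :=
  GRing.isLinear.Build algC V V _ (clifford v) (clifford_linear v).

Lemma clifford_anticommutator v w F :
  clifford v (clifford w F) + clifford w (clifford v F) =
  (2 * \sum_i v i * w i) *: F.
Proof.
apply/ffunP => p; rewrite !ffunE.
pose t i j := v i * w j * ((-1) ^+ p i * (-1) ^+ (p j (+) bits_above i j)
   * F (bits_add (bits_add p (bits_above i)) (bits_above j))).
pose t' i j := v i * w j * ((-1) ^+ p j * (-1) ^+ (p i (+) bits_above j i)
   * F (bits_add (bits_add p (bits_above j)) (bits_above i))).
transitivity (\sum_i \sum_j (t i j + t' i j)).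
  rewrite [RHS](eq_bigr (fun i => \sum_j t i j + \sum_j t' i j)); last first.
    by move=> i _; rewrite big_split.
  rewrite big_split; congr (_ + _).
    apply: eq_bigr => i _; rewrite !ffunE mulr_sumr; apply: eq_bigr => j _.
    by rewrite /t !ffunE; ring.
  rewrite [RHS]exchange_big; apply: eq_bigr => i _.
  rewrite !ffunE mulr_sumr; apply: eq_bigr => j _.
  by rewrite /t' !ffunE; ring.
rewrite /GRing.scale /= -mulrA mulr_suml mulr_sumr; apply: eq_bigr => i _.
rewrite (bigD1 i) //= big1 ?addr0 => [|j jDi].
  rewrite /t /t' bits_addK ffunE ltnn addbF -expr2 sqrr_sign; ring.
(* for distinct i and j, exactly one shift flips the bit read by the other *)
rewrite /t /t' -mulrDr [X in _ + X](_ : _ =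
  - ((-1) ^+ p i * (-1) ^+ (p j (+) bits_above i j)
     * F (bits_add (bits_add p (bits_above i)) (bits_above j)))) ?subrr ?mulr0 //.
rewrite [in LHS]bits_addAC -mulNr; congr (_ * _).
rewrite !ffunE.
have ->: (enum_rank i < enum_rank j)%N = ~~ (enum_rank j < enum_rank i)%N.
  rewrite -leqNgt ltn_neqAle; case: eqP => // /val_inj/enum_rank_inj e.
  by rewrite e eqxx in jDi.
case: (p i); case: (p j); case: (_ < _)%N;
  by rewrite /= ?expr0 ?expr1 ?mulrNN ?mulr1 ?mul1r ?opprK.
Qed.
End CliffordOperators.

Section CliffordGram.
Variables (S : finType) (B : S -> S -> algC).
Hypothesis B_sym : forall s t, B s t = B t s.
Hypothesis B_diag : forall s, B s s = 1.

(** Vectors with Gram matrix B.  In the plane indexed by t, let x_t = (1, i) and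
    y_t = (1, -i) / 2, isotropic vectors with product one; then this is the vector
    x_s + sum_t (B s t / 2) y_t. *)
Definition gram_vector (s : S) (i : S * bool) : algC :=
  if i.2 then 'i * ((s == i.1)%:R - B s i.1 / 4)
  else (s == i.1)%:R + B s i.1 / 4.

Lemma gram_vectorE s t : \sum_i gram_vector s i * gram_vector t i = B s t.
Proof.
pose st_term i b := gram_vector s (i, b) * gram_vector t (i, b).
rewrite (eq_bigr (fun i => st_term i.1 i.2)); last by case.
rewrite -(pair_big xpredT xpredT st_term) /st_term /=.
transitivity (\sum_i ((i == s)%:R * (B t i / 2) + (i == t)%:R * (B s i / 2))).
  apply: eq_bigr => u _; rewrite big_bool /gram_vector /= (eq_sym s) (eq_sym t).
  have e (x y : algC) : 'i * x * ('i * y) = - (x * y).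
    by rewrite mulrACA -expr2 sqrCi mulN1r.
  by rewrite e; field.
rewrite big_split /=; have d (f : S -> algC) r : \sum_i (i == r)%:R * f i = f r.
  by rewrite (bigD1 r) //= eqxx mul1r big1 ?addr0 // => i /negPf->; rewrite mul0r.
by rewrite !d (B_sym t s); field.
Qed.

Definition gram_op (s : S) (F : clifford_module (S * bool)%type) :
  clifford_module (S * bool)%type := clifford (gram_vector s) F.
HB.instance Definition _ (s : S) :=
  GRing.isLinear.Build algC _ _ _ (gram_op s) (clifford_linear (gram_vector s)).

Lemma gram_op_anticommutator s t F :
  gram_op s (gram_op t F) + gram_op t (gram_op s F) = (2 * B s t) *: F.
Proof. by rewrite clifford_anticommutator gram_vectorE. Qed.

Lemma gram_opK s : involutive (gram_op s).
Proof.
move=> F; have := gram_op_anticommutator s s F; rewrite B_diag mulr1.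
rewrite -mulr2n -scaler_nat; apply: scalerI; by rewrite pnatr_eq0.
Qed.

Section Power.
Variables (s t : S) (x : algC).
Hypothesis x0 : x != 0.
Hypothesis x1 : x ^+ 2 != 1.
Hypothesis Bx : 2 * B s t = x + x^-1.
Let X F := gram_op s (gram_op t F).
Let Y F := gram_op t (gram_op s F).

(** The product X of the operators of s and t is invertible and X + X^-1 is the scalar
    x + x^-1: the powers of X obey the same linear recurrence as those of x. *)
Lemma gram_op_power n F :
  (x - x^-1) *: iter n.+1 X F =
  (x ^+ n.+1 - x^-1 ^+ n.+1) *: X F - (x ^+ n - x^-1 ^+ n) *: F.
Proof.
have XY G : X (Y G) = G by rewrite /X /Y gram_opK gram_opK.
have XX G : X (X G) = (x + x^-1) *: X G - G.
  rewrite -Bx -[X in _ - X]XY; have <- := gram_op_anticommutator s t (X G).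
  have YX : Y (X G) = G by rewrite /X /Y gram_opK gram_opK.
  have <- : Y (X G) = X (Y G) by rewrite YX XY.
  by rewrite -/(X (X G)) -/(Y (X G)) addrK.
have Xlin a G H : X (a *: G - H) = a *: X G - X H.
  by rewrite /X raddfB /= linearZ_LR raddfB /= linearZ_LR.
have XZ a G : X (a *: G) = a *: X G by rewrite /X !linearZ_LR.
elim: n => [|n IHn]; first by rewrite !expr1 !expr0 subrr scale0r subr0.
rewrite iterS -XZ IHn Xlin XZ XX scalerBr scalerA.
have xx: x * x^-1 = 1 by rewrite divff.
rewrite addrAC -scalerBl; congr (_ *: _ - _).
rewrite !exprS; ring: xx.
Qed.

Let dx0 : x - x^-1 != 0.
Proof.
apply: contra x1; rewrite subr_eq0 => /eqP e.
by rewrite expr2 {2}e divff.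
Qed.

Lemma gram_op_power_sign n c : x ^+ n.+1 = c -> x^-1 ^+ n.+1 = c ->
  forall F, iter n.+1 X F = c *: F.
Proof.
move=> xc xVc F; apply: (scalerI dx0); rewrite gram_op_power xc xVc subrr scale0r.
rewrite sub0r -scaleNr scalerA; congr (_ *: _).
have -> : x ^+ n = c * x^-1 by rewrite -xc exprSr mulfK.
have -> : x^-1 ^+ n = c * x by rewrite -xVc exprSr mulfVK.
by ring.
Qed.

(** If X were the scalar c, then c^2 = 1 and 2 c = x + x^-1, that is x = c. *)
Lemma gram_op_not_scalar c : ~ (forall F, X F = c *: F).
Proof.
move=> Xc; pose F : clifford_module (S * bool)%type := [ffun=> 1].
have F0 a : a *: F = 0 -> a = 0.
  move=> /ffunP /(_ [ffun=> false]); rewrite !ffunE => h.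
  by rewrite -[LHS]mulr1; apply: h.
have tF G : gram_op t G = c *: gram_op s G.
  by rewrite -[LHS](gram_opK s) -/(X G) Xc linearZ_LR.
have c2 : c ^+ 2 = 1.
  apply/eqP; rewrite -subr_eq0; apply/eqP/F0.
  rewrite scalerBl scale1r -{2}(gram_opK t F) !tF [gram_op s (c *: _)]linearZ_LR.
  by rewrite /= gram_opK scalerA subrr.
have cB : x + x^-1 = 2 * c.
  apply/eqP; rewrite -subr_eq0; apply/eqP/F0; rewrite scalerBl -Bx.
  rewrite -gram_op_anticommutator -/(X F) Xc tF gram_opK -scalerDl.
  by rewrite -mulr2n mulr_natl subrr.
have : (x - c) ^+ 2 = 0.
  have -> : (x - c) ^+ 2 = x * (x + x^-1 - 2 * c) + (c ^+ 2 - x * x^-1) by ring.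
  by rewrite cB c2 divff // !subrr mulr0 addr0.
by move/eqP; rewrite sqrf_eq0 subr_eq0 => /eqP e; case/eqP: x1; rewrite e.
Qed.

Lemma gram_op_power_sign_inv n c :
  (forall F, iter n.+1 X F = c *: F) -> x ^+ n.+1 = x^-1 ^+ n.+1.
Proof.
move=> Xc; apply/eqP; rewrite -subr_eq0; apply/negPn/negP => a0.
pose a := x ^+ n.+1 - x^-1 ^+ n.+1; pose b := x ^+ n - x^-1 ^+ n.
apply: (@gram_op_not_scalar (a^-1 * ((x - x^-1) * c + b))) => F.
apply: (scalerI a0); rewrite scalerA mulrA divff // mul1r [RHS]scalerDl.
by rewrite -scalerA -(Xc F) gram_op_power subrK.
Qed.
End Power.
End CliffordGram.

Section CoxeterClifford.
Variables (W : coxeter_system) (eps : {set cox_gen W} -> bool).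
Local Notation S := (cox_gen W).

(** A root of unity of order m, or 2 m if [b] holds, so that its m-th power is the sign
    (-1)^b.  For infinite m any element of infinite order will do. *)
Definition cox_zeta (m : option nat) (b : bool) : algC :=
  if m is Some k then
    projT1 (C_prim_root_exists (ltn0Sn (if b then k.*2 else k).-1))
  else 2.

Lemma cox_zeta_prim k b : (0 < k)%N ->
  (if b then k.*2 else k).-primitive_root (cox_zeta (Some k) b).
Proof.
move=> k0; rewrite /cox_zeta; case: C_prim_root_exists => x /=.
by rewrite prednK //; case: b; rewrite ?double_gt0.
Qed.

Definition cox_gram (s t : S) : algC :=
  if s == t then 1 else
  let x := cox_zeta (cox_m s t) (eps [set s; t]) in (x + x^-1) / 2.

Fact cox_gram_sym s t : cox_gram s t = cox_gram t s.
Proof. by rewrite /cox_gram eq_sym cox_m_sym setUC. Qed.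

Fact cox_gram_diag s : cox_gram s s = 1.
Proof. by rewrite /cox_gram eqxx. Qed.

Lemma cox_gramE s t : s != t ->
  2 * cox_gram s t = cox_zeta (cox_m s t) (eps [set s; t]) +
                     (cox_zeta (cox_m s t) (eps [set s; t]))^-1.
Proof. by move=> /negPf st; rewrite /cox_gram st mulrC divfK // pnatr_eq0. Qed.

Hypothesis eps2 : forall s t, cox_m s t = Some 2%N -> eps [set s; t].

Lemma cox_zeta_neq0 (s t : S) : s != t -> cox_zeta (cox_m s t) (eps [set s; t]) != 0.
Proof.
move=> st; case mst: (cox_m s t) => [k|]; last by rewrite pnatr_eq0.
have k0 := ltnW (cox_m_ge2 st mst).
apply/negP => /eqP z0; have := prim_expr_order (cox_zeta_prim (eps [set s; t]) k0).
rewrite z0 expr0n; case: eps => /= /eqP; rewrite ?double_eq0 -?lt0n.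
  by rewrite (gtn_eqF k0) eq_sym oner_eq0.
by rewrite (gtn_eqF k0) eq_sym oner_eq0.
Qed.

Lemma cox_zeta_sq (s t : S) : s != t -> cox_zeta (cox_m s t) (eps [set s; t]) ^+ 2 != 1.
Proof.
move=> st; case mst: (cox_m s t) => [k|]; last by rewrite -natrX pnatr_eq1.
have k1 := cox_m_ge2 st mst; have k0 := ltnW k1.
rewrite -(prim_order_dvd (cox_zeta_prim (eps [set s; t]) k0)).
have [k2|k2] := eqVneq k 2%N.
  by rewrite (eps2 (etrans mst (congr1 Some k2))) k2.
by apply/negP => /dvdn_leq -/(_ isT); case: eps; lia.
Qed.

Lemma cox_zeta_power (s t : S) k (z := cox_zeta (cox_m s t) (eps [set s; t])) :
  s != t -> cox_m s t = Some k ->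
  z ^+ k = (-1) ^+ eps [set s; t] /\ z^-1 ^+ k = (-1) ^+ eps [set s; t].
Proof.
move=> st mst; suff zk: z ^+ k = (-1) ^+ eps [set s; t].
  split=> //; rewrite exprVn zk -signr_odd.
  by case: odd; rewrite ?invrN1 ?invr1 ?expr0 ?expr1.
have k1 := cox_m_ge2 st mst; have k0 := ltnW k1.
have := cox_zeta_prim (eps [set s; t]) k0; rewrite -mst -/z.
case: eps => [pz|/prim_expr_order//]; apply/eqP; rewrite expr1.
have : (z ^+ k) ^+ 2 == 1 by rewrite -exprM muln2 (prim_expr_order pz).
rewrite sqrf_eq1 => /orP[|//]; rewrite -(prim_order_dvd pz) => /dvdn_leq -/(_ k0); lia.
Qed.

Local Notation op := (@gram_op _ cox_gram).
Local Notation V := (clifford_module (S * bool)%type).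

Fact clifford_rel (s t : S) k : s != t -> cox_m s t = Some k -> forall F : V,
  iter k (op s \o op t) F = iter (eps [set s; t]) -%R F.
Proof.
move=> st mst F; have [zk zVk] := cox_zeta_power st mst.
have := cox_m_ge2 st mst; case: k mst zk zVk => // k mst zk zVk _.
rewrite (gram_op_power_sign cox_gram_sym cox_gram_diag (cox_zeta_neq0 st)
  (cox_zeta_sq st) (cox_gramE st) zk zVk).
by case: eps; rewrite /= ?expr1 ?expr0 ?scaleN1r ?scale1r.
Qed.

(** All signs can be prescribed except on commuting pairs: there x = 1/x is excluded,
    so x^2 = -1. *)
Definition clifford_action : twisted_action W :=
  @TwistedAction W V -%R op (fun s t => eps [set s; t]) (@opprK _)
    (gram_opK cox_gram_sym cox_gram_diag) (fun s F => raddfN (op s) F) clifford_rel.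
End CoxeterClifford.

(** Let all signs of the Clifford action be -1, so that x has order 2 m.  If (s t)^n = 1
    then X^n is a sign, which forces x^n = x^-n, that is, m is finite and
    2 m divides 2 n. *)
Lemma coxeter_gen_order (W : coxeter_system) (s t : cox_gen W) n : s != t ->
  ((pres_gen (@coxeter_relator W) s * pres_gen _ t) ^+ n.+1 = 1)%g ->
  exists2 k, cox_m s t = Some k & (k %| n.+1)%N.
Proof.
move=> st; pose eps := fun A : {set cox_gen W} => true.
rewrite -word_eval_alternating word_eval_gen => /presented_eqP e.
have [b eb] := tw_word_eval (clifford_action (eps := eps) (fun _ _ _ => isT)) e.
have X F : iter n.+1 (fun F => gram_op (cox_gram eps) s (gram_op (cox_gram eps) t F)) F
   = (-1) ^+ b *: F.
  have := eb F; rewrite word_eval_alternating eqperm_expgE /word_eval big_nil /= => ->.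
  by case: b {eb} => /=; rewrite ?expr1 ?expr0 ?scaleN1r ?scale1r.
have := gram_op_power_sign_inv (@cox_gram_sym W eps) (@cox_gram_diag W eps)
  (@cox_zeta_neq0 W eps _ _ st) (@cox_zeta_sq W eps (fun _ _ _ => isT) _ _ st)
  (@cox_gramE W eps _ _ st) X.
case mst: (cox_m s t) => [k|]; last first.
  rewrite /cox_zeta exprVn => zn.
  have : (2 : algC) ^+ n.+1 * 2 ^+ n.+1 == 1.
    by rewrite {2}zn divff // expf_neq0 // pnatr_eq0.
  by rewrite -exprD -natrX pnatr_eq1 addnS expnS; case: (2 ^ _)%N => [|[|]].
have k0 := ltnW (cox_m_ge2 st mst).
set z := cox_zeta _ _ => zn; exists k => //.
have : k.*2.-primitive_root z := cox_zeta_prim true k0.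
move=> pz; have: z ^+ (n.+1).*2 == 1.
  rewrite -addnn exprD {2}zn -exprMn divff ?expr1n //.
  by have := @cox_zeta_neq0 W eps _ _ st; rewrite mst.
by rewrite -(prim_order_dvd pz) -!muln2 dvdn_pmul2r.
Qed.

(** * The reflection actions *)

Local Notation gen W s := (pres_gen (@coxeter_relator W) s).

Section CoxeterRelations.
Variable W : coxeter_system.
Local Notation S := (cox_gen W).
Local Open Scope group_scope.

Lemma gen_power (s t : S) k : cox_m s t = Some k -> (gen W s * gen W t) ^+ k = 1.
Proof.
move=> mst; rewrite -word_eval_alternating word_eval_gen; apply/presented_eqP.
by rewrite -[X in pres_eq _ X]cats0; apply: (pres_relator [::]); exists s, t, k.
Qed.

Lemma gen2 (s : S) : gen W s * gen W s = 1.
Proof. by have := gen_power (cox_m_diag s); rewrite expg1. Qed.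

Lemma genV (s : S) : (gen W s)^-1 = gen W s.
Proof. exact/mulg1_eq/gen2. Qed.

Lemma commute_gen (s t : S) : cox_m s t = Some 2%N -> commute (gen W s) (gen W t).
Proof.
move=> mst; have := gen_power mst; rewrite expg2 => stst.
have stV : (gen W s * gen W t)^-1%g = (gen W s * gen W t) by apply: mulg1_eq.
by rewrite /commute -[LHS]stV invgM !genV.
Qed.

Lemma gen_dihedral (s t : S) i (u := gen W s * gen W t) :
  gen W t ^ u ^+ i = gen W t * u ^+ (i + i).
Proof.
have ut : gen W t * u = u^-1 * gen W t by rewrite invgM !genV -mulgA.
rewrite conjgE expgnDr mulgA [RHS]mulgA; congr (_ * _).
elim: i => [|i IHi]; first by rewrite !expg0 invg1 mul1g mulg1.
rewrite expgS invgM -mulgA -ut mulgA IHi.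
by rewrite -mulgA -expgSr expgS.
Qed.
End CoxeterRelations.

Section ReflectionAction.
Variables (W : coxeter_system) (M : Type) (z : M -> M).
Local Notation S := (cox_gen W).
Local Notation C := (coxeter_group W).
Variables (x : C -> M -> M) (P : C -> C -> bool).
Local Open Scope group_scope.
Hypothesis zK : involutive z.
Hypothesis xK : forall g, involutive (x g).
Hypothesis xz : forall g m, x g (z m) = z (x g m).
Hypothesis xC : forall g h m, x g (x h m) = iter (P g h) z (x h (x g m)).
Hypothesis P_conj : forall g h w, P (g ^ w) (h ^ w) = P g h.

(** The fibre coordinate is moved by the operator of the reflection crossed when going
    from w to s w in the Cayley graph. *)
Definition refl_gen (s : S) (p : C * M) : C * M :=
  (gen W s * p.1, x (gen W s ^ p.1) p.2).
Definition refl_flip (p : C * M) : C * M := (p.1, z p.2).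

Fact refl_flipK : involutive refl_flip.
Proof. by case=> w m; rewrite /refl_flip /= zK. Qed.

Fact refl_genK s : involutive (refl_gen s).
Proof.
case=> w m; rewrite /refl_gen /= mulgA gen2 mul1g conjgM.
by rewrite [gen W s ^ gen W s]conjgE mulKg xK.
Qed.

Fact refl_genC s p : refl_gen s (refl_flip p) = refl_flip (refl_gen s p).
Proof. by case: p => w m; rewrite /refl_gen /refl_flip /= xz. Qed.

Definition refl_act (l : seq C) (m : M) : M := foldl (fun m g => x g m) m l.

(** The exponent of the sign by which a product of the operators x_g squares: each
    pair of factors has to be interchanged once. *)
Fixpoint inversion_parity (l : seq C) : bool :=
  if l is g :: l' then
    (\big[addb/false]_(h <- l') P g h) (+) inversion_parity l'
  else false.

Lemma refl_act_cons g l m : refl_act (g :: l) m = refl_act l (x g m).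
Proof. by []. Qed.

Lemma refl_act_flip l n m : refl_act l (iter n z m) = iter n z (refl_act l m).
Proof.
elim: l m => // g l IHl m; rewrite !refl_act_cons -IHl; congr (refl_act l _).
by elim: (n) => //= k <-; rewrite xz.
Qed.

Lemma refl_act_comm g l m :
  x g (refl_act l m) = iter (\big[addb/false]_(h <- l) P g h) z (refl_act l (x g m)).
Proof.
elim: l m => [|h l IHl] m; first by rewrite big_nil.
by rewrite big_cons !refl_act_cons IHl xC refl_act_flip addbC iter_addb.
Qed.

(** The operator x_g of the second copy is pulled through the first copy of the
    remaining factors, where it meets its other occurrence and cancels. *)
Lemma refl_act_double l m :
  refl_act l (refl_act l m) = iter (inversion_parity l) z m.
Proof.
elim: l m => // g l IHl m; rewrite !refl_act_cons.
by rewrite refl_act_comm xK refl_act_flip IHl iter_addb.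
Qed.

Lemma inversion_parity_conj l w :
  inversion_parity [seq g ^ w | g <- l] = inversion_parity l.
Proof.
elim: l => //= g l ->; rewrite big_map; congr (_ (+) _).
by apply: eq_bigr => h _; rewrite P_conj.
Qed.

Definition dihedral_reflections (s t : S) k : seq C :=
  [seq gen W t * (gen W s * gen W t) ^+ i | i <- iota 0 k].

Definition refl_sign (s t : S) : bool :=
  if cox_m s t is Some k then inversion_parity (dihedral_reflections s t k) else false.

(** The reflections crossed by the alternating word in s and t are t (s t)^i,
    conjugated by w. *)
Lemma iter_refl_gen s t n w m :
  iter n (refl_gen s \o refl_gen t) (w, m) =
  ((gen W s * gen W t) ^+ n * w,
   refl_act [seq g ^ w | g <- dihedral_reflections s t n.*2] m).
Proof.
elim: n => [|n IHn]; first by rewrite mul1g.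
rewrite doubleS -(addn2 n.*2) /dihedral_reflections iotaD add0n map_cat map_cat.
rewrite /refl_act foldl_cat iterS IHn /refl_gen /refl_act /=.
set u := gen W s * gen W t.
have -> : gen W t ^ (u ^+ n * w) = (gen W t * u ^+ n.*2) ^ w.
  by rewrite conjgM gen_dihedral addnn.
have -> : gen W s ^ (gen W t * (u ^+ n * w)) = (gen W t * u ^+ n.*2.+1) ^ w.
  rewrite !conjgM; congr (_ ^ w); rewrite [gen W s ^ _]conjgE genV -/u.
  rewrite conjMg gen_dihedral addnn -mulgA; congr (_ * _).
  by rewrite conjgE (commuteX n (commute_refl u)) mulKg -expgSr.
by congr (_, _); rewrite expgS !mulgA.
Qed.

(** As (s t)^k = 1, the 2 k reflections crossed around a polygon form a sequence of
    period k, whence the square of a product; conjugation by w is immaterial. *)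
Fact refl_rel (s t : S) k : s != t -> cox_m s t = Some k -> forall p : C * M,
  iter k (refl_gen s \o refl_gen t) p = iter (refl_sign s t) refl_flip p.
Proof.
move=> st mst [w m]; rewrite iter_refl_gen (gen_power mst) mul1g.
have -> : dihedral_reflections s t k.*2 =
    dihedral_reflections s t k ++ dihedral_reflections s t k.
  rewrite /dihedral_reflections -addnn iotaD map_cat add0n; congr (_ ++ _).
  have ->: iota k k = map (addn k) (iota 0 k) by rewrite -iotaDl addn0.
  rewrite -map_comp; apply: eq_map => i /=.
  by rewrite expgnDr (gen_power mst) mul1g.
rewrite map_cat /refl_act foldl_cat -!/(refl_act _ _) refl_act_double.
rewrite inversion_parity_conj /refl_sign mst.
by case: inversion_parity.
Qed.

Definition reflection_action : twisted_action W :=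
  @TwistedAction W (C * M)%type refl_flip refl_gen refl_sign refl_flipK refl_genK
    refl_genC refl_rel.

Lemma refl_sign_commuting s t : cox_m s t = Some 2%N ->
  refl_sign s t = P (gen W t) (gen W s).
Proof.
move=> mst; have := gen_power mst; rewrite /refl_sign mst expg2 => e.
rewrite /= !big_cons !big_nil !addbF mulg1 expg1; congr (P _ _).
by apply/esym; rewrite -[LHS]genV; apply: mulg1_eq; rewrite mulgA.
Qed.
End ReflectionAction.

(** * Reduced words and coset representatives *)

Section Deletion.
Variable W : coxeter_system.
Local Notation S := (cox_gen W).
Local Notation C := (coxeter_group W).
Local Open Scope group_scope.

Definition gprod (a : seq S) : C := \prod_(s <- a) gen W s.

Lemma gprod_nil : gprod [::] = 1. Proof. exact: big_nil. Qed.
Lemma gprod_cons s a : gprod (s :: a) = gen W s * gprod a.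
Proof. exact: big_cons. Qed.
Lemma gprod_cat a b : gprod (a ++ b) = gprod a * gprod b.
Proof. exact: big_cat. Qed.
Lemma gprod1 s : gprod [:: s] = gen W s.
Proof. by rewrite gprod_cons gprod_nil mulg1. Qed.

Lemma gprodV a : (gprod a)^-1 = gprod (rev a).
Proof.
elim: a => [|s a IHa]; first by rewrite gprod_nil invg1.
by rewrite gprod_cons invgM IHa genV rev_cons -cats1 gprod_cat gprod1.
Qed.

Lemma gprod_pi a : gprod a = \pi_C [seq (s, false) | s <- a].
Proof. by rewrite -[RHS]word_eval_gen /word_eval big_map. Qed.

Lemma gprod_surj g : exists a, gprod a = g.
Proof.
exists [seq l.1 | l <- repr g]; rewrite -[RHS]reprK -[RHS]word_eval_gen.
rewrite /gprod big_map /word_eval; apply: eq_bigr => -[s b] _ /=.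
by case: b; rewrite ?genV.
Qed.

Fixpoint reflections (a : seq S) : seq C :=
  if a is s :: a' then gen W s ^ gprod a' :: reflections a' else [::].

Lemma size_reflections a : size (reflections a) = size a.
Proof. by elim: a => //= s a ->. Qed.

Definition toggle (g : C) (phi : C -> bool) : C -> bool :=
  fun h => phi h (+) (h == g).

Fact toggleK g : involutive (toggle g).
Proof. by move=> phi; apply/funext => h; rewrite /toggle -addbA addbb addbF. Qed.

Fact toggleC g h phi : toggle g (toggle h phi) = toggle h (toggle g phi).
Proof. by apply/funext => k; rewrite /toggle addbAC. Qed.

(** With x_g toggling the membership of g in a set, all signs are trivial, and a word
    acts by its reflections counted modulo two. *)
Definition parity_action : twisted_action W :=
  @reflection_action W (C -> bool) id toggle (fun _ _ => false)
    (fun=> erefl) toggleK (fun _ _ => erefl) toggleC (fun _ _ _ => erefl).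

Lemma parity_actionE a :
  word_eval (tw_perm parity_action) [seq (s, false) | s <- a] (1, fun=> false) =
  (gprod a, fun h => odd (count_mem h (reflections a))).
Proof.
elim: a => [|s a IHa]; first by rewrite /word_eval big_nil gprod_nil.
rewrite /word_eval big_cons -/(word_eval _ _) eqperm_mulE IHa /=.
rewrite /refl_gen /= gprod_cons; congr (_, _); apply/funext => h.
by rewrite /toggle oddD oddb addbC eq_sym.
Qed.

Lemma reflections_parity a b : gprod a = gprod b ->
  forall g, odd (count_mem g (reflections a)) = odd (count_mem g (reflections b)).
Proof.
rewrite !gprod_pi => /presented_eqP /(tw_word_eval parity_action)[e ab] g.
have := ab (1, fun=> false); rewrite !parity_actionE.
have flip_id (p : C * (C -> bool)) : iter e (@tw_flip _ parity_action) p = p.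
  by case: e {ab} => //; case: p.
by rewrite flip_id => -[_ /(congr1 (fun f => f g))].
Qed.

Definition is_reduced (a : seq S) :=
  forall b, gprod b = gprod a -> (size a <= size b)%N.

(** A reflection that occurs once in a word occurs an odd number of times in any other
    word for the same element. *)
Lemma uniq_reflections_reduced a : uniq (reflections a) -> is_reduced a.
Proof.
move=> Ua b ba; rewrite -size_reflections -(size_reflections b).
apply: uniq_leq_size => // g ga; have := reflections_parity ba g.
by rewrite (count_uniq_mem _ Ua) ga -has_pred1 has_count => h; case: count h.
Qed.

Lemma reflections_cat a b :
  reflections (a ++ b) = [seq g ^ gprod b | g <- reflections a] ++ reflections b.
Proof. by elim: a => //= s a ->; rewrite gprod_cat conjgM. Qed.

(** The reflection of a letter t followed by the suffix w is w^-1 t w: multiplying by it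
    on the right cancels the letter. *)
Lemma reflections_delete g b : g \in reflections b ->
  exists2 b', gprod b' = gprod b * g &
    (size b' < size b)%N /\ (forall K : pred S, all K b -> all K b').
Proof.
elim: b => //= t b IHb; rewrite inE => /predU1P[->|/IHb[b' e [sb' Kb']]].
  exists b; last by split=> // K /andP[].
  by rewrite gprod_cons -mulgA -conjgC mulgA gen2 mul1g.
exists (t :: b'); first by rewrite !gprod_cons e mulgA.
by split=> // K /= /andP[-> /Kb'].
Qed.

(** If the reflection of the first letter occurs a second time, then multiplying by the
    first letter deletes the letter responsible for the second occurrence. *)
Lemma deletion a : ~~ uniq (reflections a) ->
  exists2 b, gprod b = gprod a &
    (size b < size a)%N /\ (forall K : pred S, all K a -> all K b).
Proof.
elim: a => //= s a IHa; rewrite negb_and negbK => /orP[|/IHa].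
  case/reflections_delete=> b e [sb Kb].
  exists b; first by rewrite e -conjgC gprod_cons.
  by split=> [|K /andP[_ /Kb //]]; apply: ltnW.
case=> b e [sb Kb]; exists (s :: b); first by rewrite !gprod_cons e.
by split=> // K /= /andP[-> /Kb].
Qed.

Lemma reduced_uniq a : is_reduced a -> uniq (reflections a).
Proof.
move=> ra; apply/negPn/negP => /deletion[b ba [sb _]].
by have := ra b ba; rewrite leqNgt sb.
Qed.

Lemma reduced_word_in (K : pred S) a : all K a ->
  exists2 b, gprod b = gprod a & is_reduced b /\ all K b.
Proof.
elim: {a}_.+1 {-2}a (ltnSn (size a)) => // n IHn a; rewrite ltnS => an Ka.
have [Ua|/deletion[b e [ba Kb]]] := boolP (uniq (reflections a)).
  by exists a => //; split=> //; apply: uniq_reflections_reduced.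
have [c ce Kc] := IHn b (leq_trans ba an) (Kb K Ka).
by exists c; rewrite ?ce.
Qed.

(** Let p be shortest in its coset.  A reflection occurring twice in p ++ r would have
    to come once from p and once from r, and deleting both letters would give a
    shorter element of the coset. *)
Lemma coset_decomposition (J K : pred S) a : subpred K J -> all J a ->
  exists p q : seq S,
    [/\ all J p, all K q, gprod a = gprod p * gprod q,
      (forall p' q', all J p' -> all K q' -> gprod a = gprod p' * gprod q' ->
         (size p <= size p')%N)
    & (forall r, all K r -> is_reduced r -> is_reduced (p ++ r))].
Proof.
move=> KJ Ja.
pose Q n := `[< exists p q,
  [/\ size p = n, all J p, all K q & gprod a = gprod p * gprod q] >].
have exQ : exists n, Q n.
  by exists (size a); apply/asboolP; exists a, [::]; rewrite gprod_nil mulg1.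
case: (ex_minnP exQ) => _ /asboolP[p [q [<- Jp Kq e]]] min_p; exists p, q.
have min p' q' : all J p' -> all K q' -> gprod a = gprod p' * gprod q' ->
    (size p <= size p')%N.
  by move=> Jp' Kq' e'; apply: min_p; apply/asboolP; exists p', q'.
split=> // r Kr rr; apply: uniq_reflections_reduced.
rewrite reflections_cat cat_uniq (reduced_uniq rr) andbT.
rewrite (map_inj_uniq (@conjg_inj _ _)).
apply/andP; split.
  apply/negPn/negP => /deletion[b be [bp Jb]].
  by have := min b q (Jb J Jp) Kq; rewrite be leqNgt bp => /(_ e).
apply/hasPn => h hr; apply/negP => /mapP[g gp hg].
have [p' p'e [p'p Jp']] := reflections_delete gp.
have [r' r'e [_ Kr']] := reflections_delete hr.
have /(_ (Jp' J Jp)) := min p' (r ++ rev r' ++ q).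
rewrite !all_cat Kr Kq all_rev (Kr' K Kr) leqNgt p'p => /(_ isT) absurd.
suff: gprod a = gprod p' * gprod (r ++ rev r' ++ q) by move/absurd.
have gr : g * gprod r = gprod r * h by rewrite hg -conjgC.
rewrite !gprod_cat -gprodV p'e r'e e; move: h gr {hg hr r'e absurd} => h gr.
by rewrite -mulgA (mulgA g) gr mulVKg.
Qed.
End Deletion.

(** * Conjugacy of generators and of commuting pairs *)

Section DihedralReflections.
Variables (G : groupType) (k u c : G).
Local Open Scope group_scope.
Hypotheses (kk : k * k = 1) (kc : k * c = u) (cu : c * u = k).

Let ckc : c * (k * c) = k.
Proof. by rewrite kc cu. Qed.

(** The relation g c^i = k c^j says g = k c^(j - i) without negative exponents. *)
Lemma dihedral_conjl g i j : g * c ^+ i = k * c ^+ j ->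
  k * g * k * c ^+ j = k * c ^+ i.
Proof.
move=> e; have -> : g = k * c ^+ j * (c ^+ i)^-1 by rewrite -e mulgK.
have cVc : commute (c ^+ j) (c ^+ i)^-1.
  by apply/commuteV/commuteX/commute_sym/commuteX/commute_refl.
rewrite -(mulgA k (c ^+ j)) (mulgA k k) kk mul1g cVc -!mulgA (expg_sandwich _ ckc).
by apply: (mulgI (c ^+ i)); rewrite mulVKg (expg_sandwich _ ckc).
Qed.

Lemma dihedral_conjr g i j : g * c ^+ i = k * c ^+ j ->
  u * g * u * c ^+ j = k * (c * c ^+ i * c).
Proof.
move=> /dihedral_conjl e.
have -> : u * g * u * c ^+ j = u * g * k * c ^+ j * c.
  by rewrite -{2}kc mulgA -(mulgA _ c) -expgS expgSr mulgA.
apply: (mulgI c); rewrite !mulgA cu e.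
by rewrite -(mulgA c k) kc cu.
Qed.
End DihedralReflections.

Section Conjugacy.
Variable W : coxeter_system.
Local Notation S := (cox_gen W).
Local Notation C := (coxeter_group W).
Local Open Scope group_scope.

Lemma gen_neq1 (s : S) : gen W s != 1.
Proof.
apply/eqP => s1; have := @reflections_parity W [:: s] [::] _ (gen W s).
rewrite gprod1 gprod_nil => /(_ s1).
by rewrite /= gprod_nil conjg1 eqxx.
Qed.

Lemma gen_inj : injective (pres_gen (@coxeter_relator W)).
Proof.
move=> s t st; apply/eqP/negPn/negP => sDt.
have st1 : ((gen W s * gen W t) ^+ 1 = 1)%g by rewrite expg1 -st gen2.
have [k mst] := coxeter_gen_order sDt st1.
by rewrite dvdn1 => /eqP k1; have := cox_m_ge2 sDt mst; rewrite k1.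
Qed.

Lemma commute_gen_eq2 (s t : S) : s != t -> commute (gen W s) (gen W t) ->
  cox_m s t = Some 2%N.
Proof.
move=> sDt st; have [|k mst k2] := @coxeter_gen_order W s t 1 sDt.
  by rewrite expgMn // !expg2 !gen2 mulg1.
have := cox_m_ge2 sDt mst; have := @dvdn_leq k 2 isT k2.
by rewrite mst; case: k k2 mst => [|[|[|]]].
Qed.

(** Conjugates of k in the dihedral group are of the form k c^n with n even, whereas
    u = k c; so some odd power of c is trivial. *)
Lemma dihedral_conj (k u : S) q : k != u -> all (pred2 k u) q ->
  gprod q * gen W k = gen W u * gprod q -> odd_label (cox_m k u).
Proof.
move=> ku Kq qk; set c := gen W k * gen W u.
have [i [j e]] : exists i j,
    gen W k ^ (gprod q)^-1 * c ^+ (j + j) = gen W k * c ^+ (i + i).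
  elim: q Kq {qk} => [|x q IHq] /=.
    by exists 0%N, 0%N; rewrite gprod_nil invg1 conjg1.
  case/andP=> xku /IHq[i [j e]]; rewrite gprod_cons invgM conjgM.
  rewrite [_ ^ (gen W x)^-1]conjgE invgK genV mulgA.
  have kc : gen W k * c = gen W u by rewrite mulgA gen2 mul1g.
  have cu : c * gen W u = gen W k by rewrite -mulgA gen2 mulg1.
  case/pred2P: xku => ->.
    by exists j, i; apply: dihedral_conjl (gen2 k) kc cu _ _ _ e.
  exists j.+1, i; rewrite addSn addnS expgSr expgS.
  exact: dihedral_conjr (gen2 k) kc cu _ _ _ e.
have : gen W u * c ^+ (j + j) = gen W k * c ^+ (i + i).
  by rewrite -e conjgE invgK mulgA qk mulgK.
rewrite -[X in X * _](mulKg (gen W k)) genV -mulgA -/c -expgS => /mulgI ij.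
have odd_order n : c ^+ n = 1 -> odd n -> odd_label (cox_m k u).
  case: n => // n cn on; have [m -> mn] := coxeter_gen_order ku cn.
  exact: dvdn_odd mn on.
have [ij'|ij'] := leqP (i + i) (j + j).+1.
  apply: (odd_order ((j + j).+1 - (i + i))%N); last first.
    by rewrite oddB //= !addnn !odd_double.
  by rewrite expgnFr // ij mulgV.
apply: (odd_order ((i + i) - (j + j).+1)%N); last first.
  by rewrite oddB ?(ltnW ij') //= !addnn !odd_double.
by rewrite expgnFr ?(ltnW ij') // ij mulgV.
Qed.

(** Let r be a reduced word in K for the conjugate of k by q.  Then p r = k' p has
    length at most one more than that of p, but also the sum of the lengths of p and
    r: so r is a single letter. *)
Lemma coset_step (p q : seq S) (K : pred S) (k k' : S) :
  all K q -> K k -> (forall r, all K r -> is_reduced r -> is_reduced (p ++ r)) ->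
  gprod p * gprod q * gen W k = gen W k' * (gprod p * gprod q) ->
  exists k2, [/\ K k2, gprod q * gen W k = gen W k2 * gprod q &
     gprod p * gen W k2 = gen W k' * gprod p].
Proof.
move=> Kq Kk pr e.
have [|r re [rr Kr]] := @reduced_word_in W K (q ++ k :: rev q).
  by rewrite all_cat /= all_rev Kq Kk.
have {}re : gprod r = gprod q * gen W k * (gprod q)^-1.
  by rewrite re gprod_cat gprod_cons gprodV mulgA.
have pre : gprod p * gprod r = gen W k' * gprod p.
  by rewrite re !mulgA e !mulgA mulgK.
have := pr r Kr rr (k' :: p); rewrite gprod_cons gprod_cat pre => /(_ erefl).
rewrite size_cat /= -addn1 leq_add2l.
case: r re {rr} pre Kr => [|k2 [|//]] re pre Kr _.
  case/eqP: (gen_neq1 k); apply: (mulgI (gprod q)); apply: (mulIg (gprod q)^-1).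
  by rewrite -re mulg1 mulgV gprod_nil.
rewrite gprod1 in re pre; exists k2; split=> //; first by case/andP: Kr.
by rewrite re mulgVK.
Qed.

Definition odd_adj_in (J : pred S) : rel S :=
  fun x y => [&& J x, J y & odd_adj x y].

(** Split off the shortest representative p of the coset of the word modulo the subgroup
    generated by k and the last letter u.  The other factor is dihedral: it sends k
    to k, or to u across an odd edge; and p is shorter than the word. *)
Lemma gen_conj_connect (J : pred S) a k k' : all J a -> J k ->
  gprod a * gen W k = gen W k' * gprod a -> connect (odd_adj_in J) k k'.
Proof.
elim: {a}_.+1 {-2}a (ltnSn (size a)) k => // n IHn a; rewrite ltnS => an k Ja Jk e.
case/lastP: a an Ja e => [|a u] an Ja e.
  have -> : k = k'; last exact: connect0.
  by apply: gen_inj; move: e; rewrite gprod_nil mul1g mulg1.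
rewrite size_rcons in an; have /andP[Ju Ja'] : J u && all J a by rewrite -all_rcons.
pose K := pred2 k u.
have KJ : subpred K J by move=> x /pred2P[]->.
have [p [q [Jp Kq apq min_p ext_p]]] := coset_decomposition KJ Ja.
have pa : (size p <= size a)%N.
  by apply: (min_p a [:: u]); rewrite //= ?eqxx ?orbT // -gprod_cat cats1.
rewrite apq in e.
have Kk : K k by rewrite /K /= eqxx.
have [k2 [Kk2 qk pk2]] := coset_step Kq Kk ext_p e.
have Jk2 := KJ _ Kk2.
apply: connect_trans (IHn p (leq_ltn_trans pa an) k2 Jp Jk2 pk2).
have [->|kk2] := eqVneq k k2; first exact: connect0.
have k2u : k2 = u by case/pred2P: Kk2 kk2 => -> //; rewrite eqxx.
subst k2; apply/connect1/and3P; split=> //.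
by rewrite /odd_adj kk2; apply: dihedral_conj qk.
Qed.

Lemma odd_adj_neq2 (s t : S) : odd_adj s t -> cox_m s t != Some 2%N.
Proof. by case/andP=> _; case: (cox_m s t) => [[|[|[|n]]]|]. Qed.

Lemma commuting_neq (s t : S) : cox_m s t = Some 2%N -> s != t.
Proof. by move=> st; apply/eqP => e; move: st; rewrite e cox_m_diag. Qed.

Lemma bullet_connect (A B : commuting_pair W) (s t1 t2 : S) :
  val A = [set s; t1] -> val B = [set s; t2] -> odd_label (cox_m t1 t2) ->
  connect (@bullet_adj W) A B.
Proof.
move=> eA eB o; have [->|AB] := eqVneq A B; first exact: connect0.
apply/connect1/andP; split=> //.
apply/existsP; exists s; apply/existsP; exists t1; apply/existsP; exists t2.
by apply/and3P; split; rewrite ?o; apply/eqP.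
Qed.

Fact commuting_is_pair (s t : S) :
  cox_m s t = Some 2%N -> is_commuting_pair [set s; t].
Proof.
by move=> st; apply/existsP; exists s; apply/existsP; exists t; rewrite st !eqxx.
Qed.

(** As in [gen_conj_connect], a factor in the subgroup generated by s, t and the last
    letter u is split off.  It sends the pair of s and t to a commuting pair among these
    three generators; if that pair is a different one, there is only one
    odd edge available within the three generators, and it makes the two pairs
    adjacent. *)
Lemma commuting_conj_connect a (A B : commuting_pair W) (s t s' t' : S) :
  cox_m s t = Some 2%N -> val A = [set s; t] -> val B = [set s'; t'] ->
  gprod a * gen W s = gen W s' * gprod a ->
  gprod a * gen W t = gen W t' * gprod a ->
  connect (@bullet_adj W) A B.
Proof.
elim: {a}_.+1 {-2}a (ltnSn (size a)) s t A => // n IHn a; rewrite ltnS.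
move=> an s t A st eA eB es et.
case/lastP: a an es et => [|a u] an es et.
  have -> : A = B; last exact: connect0.
  have {}es: s = s' by apply: gen_inj; move: es; rewrite gprod_nil mul1g mulg1.
  have {}et: t = t' by apply: gen_inj; move: et; rewrite gprod_nil mul1g mulg1.
  by apply: val_inj; rewrite eA eB es et.
rewrite size_rcons in an.
pose K := [pred x | [|| x == s, x == t | x == u]].
have [Ks Kt Ku] : [/\ K s, K t & K u] by rewrite /K /= !eqxx ?orbT.
have KT : subpred K predT by [].
have [p [q [_ Kq apq min_p ext_p]]] :=
  coset_decomposition KT (all_predT (rcons a u)).
have pa : (size p <= size a)%N.
  apply: (min_p a [:: u]); first exact: all_predT.
    by rewrite /= !eqxx !orbT.
  by rewrite -gprod_cat cats1.
rewrite apq in es et.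
have [k1 [Kk1 qs pk1]] := coset_step Kq Ks ext_p es.
have [k2 [Kk2 qt pk2]] := coset_step Kq Kt ext_p et.
have sDt := commuting_neq st.
have k12 : k1 != k2.
  apply: contra sDt => /eqP k12; apply/eqP/gen_inj/(mulgI (gprod q)).
  by rewrite qs qt k12.
have ck := commute_gen st.
have conj_k (x k : S) : gprod q * gen W x = gen W k * gprod q ->
    gen W k = gen W x ^ (gprod q)^-1.
  by move=> e; rewrite conjgE invgK mulgA e mulgK.
have mk : cox_m k1 k2 = Some 2%N.
  apply: commute_gen_eq2 => //; rewrite (conj_k _ _ qs) (conj_k _ _ qt).
  by rewrite /commute -!conjMg ck.
pose D : commuting_pair W := Sub _ (commuting_is_pair mk).
have eD : val D = [set k1; k2] by [].
apply: connect_trans (IHn p (leq_ltn_trans pa an) k1 k2 D mk eD eB pk1 pk2).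
have c1 := gen_conj_connect Kq Ks qs; have c2 := gen_conj_connect Kq Kt qt.
have sym (x y : S) : cox_m x y = Some 2%N -> cox_m y x = Some 2%N.
  by rewrite cox_m_sym.
have no (x y : S) : cox_m x y = Some 2%N -> odd_adj x y = false.
  by move=> xy; apply/negbTE/negP => /odd_adj_neq2; rewrite xy eqxx.
have isolated (x k : S) : connect (odd_adj_in K) x k -> x != k ->
    (forall y, K y -> odd_adj x y -> odd_adj x u) -> odd_adj x u.
  by move=> /connect_first h /h[y /and3P[_ Ky xy]] hx; apply: hx xy.
have s_u : s != k1 -> odd_adj s u.
  move=> sk; apply: isolated c1 sk _ => y /or3P[]/eqP-> //.
    by rewrite /odd_adj eqxx.
  by rewrite no.
have t_u : t != k2 -> odd_adj t u.
  move=> tk; apply: isolated c2 tk _ => y /or3P[]/eqP-> //.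
    by rewrite no // sym.
  by rewrite /odd_adj eqxx.
have odd_of (x : S) : odd_adj x u -> odd_label (cox_m x u) by case/andP.
(* odd edges inside {s, t, u} must contain u, since s and t commute *)
have [k1s|k1s] := eqVneq k1 s.
  have [k2t|k2t] := eqVneq k2 t.
    by have -> : A = D; [apply: val_inj; rewrite eD eA k1s k2t|exact: connect0].
  have k2u : k2 = u.
    case/or3P: Kk2 => /eqP // e; first by rewrite k1s e eqxx in k12.
    by rewrite e eqxx in k2t.
  have tu : odd_adj t u by apply: t_u; rewrite eq_sym.
  by apply: (bullet_connect eA _ (odd_of _ tu)); rewrite eD k1s k2u.
have su : odd_adj s u by apply: s_u; rewrite eq_sym.
have [k2t|k2t] := eqVneq k2 t.
  have k1u : k1 = u.
    case/or3P: Kk1 => /eqP // e; first by rewrite e eqxx in k1s.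
    by rewrite e k2t eqxx in k12.
  apply: (bullet_connect (s := t) _ _ (odd_of _ su)); first by rewrite eA setUC.
  by rewrite eD k1u k2t setUC.
have tu : odd_adj t u by apply: t_u; rewrite eq_sym.
have [k1t|k1t] := eqVneq k1 t.
  have [k2s|k2s] := eqVneq k2 s.
    have -> : A = D; last exact: connect0.
    by apply: val_inj; rewrite eD eA k1t k2s setUC.
  have k2u : k2 = u by case/or3P: Kk2 => /eqP // e; rewrite e eqxx in k2s k2t.
  by move: tu; rewrite -k1t -k2u no.
have k1u : k1 = u by case/or3P: Kk1 => /eqP // e; rewrite e eqxx in k1s k1t.
have k2s : k2 = s.
  case/or3P: Kk2 => /eqP // e; first by rewrite e eqxx in k2t.
  by rewrite e k1u eqxx in k12.
by move: su; rewrite -k1u -k2s no // sym.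
Qed.
End Conjugacy.

(** * The action attached to a component of commuting pairs *)

Section ComponentAction.
Variables (W : coxeter_system) (A0 : commuting_pair W).
Local Notation S := (cox_gen W).
Local Notation C := (coxeter_group W).
Local Open Scope group_scope.

Definition in_component (g h : C) : bool :=
  `[< exists s t w, exists st : cox_m s t = Some 2%N,
      [/\ connect (@bullet_adj W) A0 (Sub _ (commuting_is_pair st)),
          g = gen W s ^ w & h = gen W t ^ w] >].

Lemma in_component_irr g : in_component g g = false.
Proof.
apply/asboolP => -[s [t [w [st [_ -> /conjg_inj/gen_inj e]]]]].
by have := commuting_neq st; rewrite e eqxx.
Qed.

Lemma in_component_sym g h : in_component g h = in_component h g.
Proof.
suff imp g' h' : in_component g' h' -> in_component h' g' by apply/idP/idP; apply: imp.
case/asboolP=> s [t [w [st [c -> ->]]]]; apply/asboolP.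
have ts : cox_m t s = Some 2%N by rewrite cox_m_sym.
exists t, s, w, ts; split=> //; congr (connect _ _ _) : c.
by apply: val_inj; rewrite /= setUC.
Qed.

Lemma in_component_conj g h w : in_component (g ^ w) (h ^ w) = in_component g h.
Proof.
suff imp g' h' w' : in_component g' h' -> in_component (g' ^ w') (h' ^ w').
  by apply/idP/idP; [move/(imp _ _ w^-1); rewrite !conjgK|apply: imp].
case/asboolP=> s [t [v [st [c -> ->]]]]; apply/asboolP.
by exists s, t, (v * w'), st; rewrite !conjgM.
Qed.

(** Here conjugacy in W, which is what makes [in_component] invariant, is compared
    with connectedness in the diagram. *)
Lemma in_component_gen (s t : S) (st : cox_m s t = Some 2%N) :
  in_component (gen W t) (gen W s) =
  connect (@bullet_adj W) A0 (Sub _ (commuting_is_pair st)).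
Proof.
rewrite in_component_sym; apply/asboolP/idP => [|c]; last first.
  by exists s, t, 1, st; rewrite !conjg1.
case=> [s' [t' [w [st' [c sw tw]]]]]; apply: connect_trans c _.
have [a aw] := gprod_surj w^-1.
have conj (x y : S) : gen W x = gen W y ^ w -> gprod a * gen W y = gen W x * gprod a.
  by move=> ->; rewrite aw conjgE mulgA mulgK.
by apply: (commuting_conj_connect st' _ _ (conj _ _ sw) (conj _ _ tw)); rewrite SubK.
Qed.

Definition word_code (g : C) : nat := pickle (repr g).
Fact word_code_inj : injective word_code.
Proof. by move=> g h /(pcan_inj pickleK) e; rewrite -[g]reprK e reprK. Qed.

(** A bilinear form whose antisymmetrization is [in_component], obtained from an
    arbitrary linear order on W. *)
Definition oriented (g h : C) : bool :=
  in_component g h && (word_code g < word_code h)%N.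

Lemma oriented_sym g h : oriented g h (+) oriented h g = in_component g h.
Proof.
rewrite /oriented (in_component_sym h g); have [->|gh] := eqVneq g h.
  by rewrite in_component_irr.
case: in_component => //=; case: ltngtP => // /word_code_inj e.
by rewrite e eqxx in gh.
Qed.

Definition heisenberg := ((C -> bool) * bool)%type.
Definition heisenberg_flip (m : heisenberg) : heisenberg := (m.1, ~~ m.2).
(** A Heisenberg group action: translation by the linear form of g, together with
    evaluation at g.  Two of these operators commute up to the antisymmetrization
    of [oriented]. *)
Definition heisenberg_op (g : C) (m : heisenberg) : heisenberg :=
  (fun h => m.1 h (+) oriented g h, m.2 (+) m.1 g).

Fact heisenberg_flipK : involutive heisenberg_flip.
Proof. by case=> phi b; rewrite /heisenberg_flip /= negbK. Qed.

Fact heisenberg_opK g : involutive (heisenberg_op g).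
Proof.
case=> phi b; rewrite /heisenberg_op /=; congr (_, _).
  by apply/funext => h; rewrite -addbA addbb addbF.
by rewrite /oriented ltnn andbF addbF -addbA addbb addbF.
Qed.

Fact heisenberg_op_flip g m :
  heisenberg_op g (heisenberg_flip m) = heisenberg_flip (heisenberg_op g m).
Proof. by case: m => phi b; rewrite /heisenberg_op /heisenberg_flip /= addNb. Qed.

Fact heisenberg_opC g h m : heisenberg_op g (heisenberg_op h m) =
  iter (in_component g h) heisenberg_flip (heisenberg_op h (heisenberg_op g m)).
Proof.
case: m => phi b; rewrite -oriented_sym /heisenberg_op /=.
have iterE (c : bool) f d : iter c heisenberg_flip (f, d) = (f, c (+) d).
  by case: c.
rewrite iterE; congr (_, _); first by apply/funext => k; rewrite addbAC.
by case: (oriented g h); case: (oriented h g); case: (phi g); case: (phi h); case: b.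
Qed.

Definition component_action : twisted_action W :=
  @reflection_action W heisenberg heisenberg_flip heisenberg_op in_component
    heisenberg_flipK heisenberg_opK heisenberg_op_flip heisenberg_opC
    in_component_conj.

Lemma component_action_sign (s t : S) (st : cox_m s t = Some 2%N) :
  tw_sign component_action s t =
  connect (@bullet_adj W) A0 (Sub _ (commuting_is_pair st)).
Proof. by rewrite -in_component_gen -refl_sign_commuting. Qed.

Lemma component_action_flip : exists m, @tw_flip _ component_action m <> m.
Proof. by exists (1, (fun=> false, false)). Qed.
End ComponentAction.

(** * The classes of the Coxeter relators *)

Section BoundaryHom.
Variable G : groupType.
Local Notation E := (cocycle_ext (bar_cocycle G)).

(** With the term [g] added, the boundary map becomes a homomorphism on the
    tautological extension; so it can be computed on products of lifts. *)
Definition ext_d2 (e : E) : {freeg G / int} := coker_d2 e.2 + << e.1 >>.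

Lemma ext_d2M e f : ext_d2 (e * f)%g = ext_d2 e + ext_d2 f.
Proof.
case: e f => [g x] [h y]; rewrite ext_mulE /ext_d2 /= !raddfD /=.
rewrite coker_d2E /bar_d2 fgliftU1 -(addrA (_ + _)) (addrAC << h >>) subrK.
by rewrite [RHS]addrACA (addrC << g >>).
Qed.

Lemma ext_d2_in x : ext_d2 (ext_in (bar_cocycle G) x) = coker_d2 x.
Proof.
rewrite /ext_d2 /ext_in raddfB /= coker_d2E /bar_d2 fgliftU1 mulg1.
by rewrite subrr add0r subrK.
Qed.

Lemma ext_d2X e n : ext_d2 (e ^+ n)%g = ext_d2 e *+ n.
Proof.
elim: n => [|n IHn]; last by rewrite expgS ext_d2M IHn mulrS.
by rewrite expg0 -(ext_in0 (bar_cocycle G)) ext_d2_in raddf0.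
Qed.
End BoundaryHom.

Section CoxeterClasses.
Variable W : coxeter_system.
Local Notation S := (cox_gen W).
Local Notation C := (coxeter_group W).
Local Notation E := (cocycle_ext (bar_cocycle C)).
Local Notation M := (bar_coker C).
Local Notation lift := (@ext_gen S (@coxeter_relator W)).
Local Notation kin := (ext_in (bar_cocycle C)).

Definition sq_class (s : S) : M := ext_val (lift s * lift s)%g.

(** Subtracting the squares makes this class have order at most two for even m, and
    boundary [s] + [t] for odd m. *)
Definition rel_class (s t : S) : M :=
  if cox_m s t is Some k then
    ext_val ((lift s * lift t) ^+ k)%g - (sq_class s + sq_class t) *+ k./2
  else 0.

Lemma sq_classE s : kin (sq_class s) = (lift s * lift s)%g.
Proof. by apply: ext_valK; rewrite gmulfM; apply: gen2. Qed.

Lemma lift_sq_central s e : commute (lift s * lift s)%g e.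
Proof. by apply: ext_ker_central; rewrite gmulfM; apply: gen2. Qed.

Lemma lift_power_proj s t k : cox_m s t = Some k ->
  ext_proj ((lift s * lift t) ^+ k)%g = 1%g.
Proof. by move=> mst; rewrite gmulfXn gmulfM; apply: gen_power. Qed.

Lemma lift_power_central s t k e : cox_m s t = Some k ->
  commute ((lift s * lift t) ^+ k)%g e.
Proof. by move=> mst; apply: ext_ker_central; apply: lift_power_proj. Qed.

Lemma rel_classE s t k : cox_m s t = Some k ->
  kin (rel_class s t + (sq_class s + sq_class t) *+ k./2) =
  ((lift s * lift t) ^+ k)%g.
Proof.
by move=> mst; rewrite /rel_class mst subrK ext_valK // lift_power_proj.
Qed.

Lemma kin_inj : injective kin.
Proof. exact: can_inj (@ext_inK _ _ _). Qed.

Lemma rel_class_sym s t : rel_class s t = rel_class t s.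
Proof.
rewrite /rel_class cox_m_sym; case mst: (cox_m t s) => [k|//].
by rewrite [X in _ - X *+ _]addrC dihedral_power_sym // => e; apply: lift_power_central.
Qed.

Lemma rel_class_double s t : rel_class s t + rel_class s t =
  if odd_label (cox_m s t) then sq_class s + sq_class t else 0.
Proof.
case mst: (cox_m s t) => [k|]; last by rewrite /rel_class mst addr0.
set a := sq_class s + sq_class t.
have e : (rel_class s t + a *+ k./2) *+ 2 = a *+ k.
  apply: kin_inj; rewrite !ext_inMn (rel_classE mst) expg2.
  rewrite dihedral_power_sq; do ?[by move=> g; apply: lift_sq_central];
    last by move=> g; apply: lift_power_central.
  by rewrite /a ext_inD !sq_classE.
rewrite -mulr2n; apply: (addIr (a *+ k./2 *+ 2)).
rewrite -mulrnDl e -mulrnA muln2 /=; case ok: (odd k).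
  by rewrite -mulrS -{1}(odd_double_half k) ok.
by rewrite add0r -{1}(odd_double_half k) ok.
Qed.

Lemma rel_class_commute s t : cox_m s t = Some 2%N ->
  kin (rel_class s t) = [~ lift t, lift s]%g.
Proof.
move=> mst; have st : commute (ext_proj (lift s)) (ext_proj (lift t)).
  exact: commute_gen.
have := rel_classE mst; rewrite (commute_square (@ext_ker_central _ _ _) st).
rewrite -[2./2]/1%N mulr1n addrC ext_inD ext_inD !sq_classE.
exact: mulgI.
Qed.
(** The classes are commutators with s, and t1 and t2 are conjugate by a power of t1 t2,
    which commutes with s. *)
Lemma rel_class_bullet s t1 t2 : cox_m s t1 = Some 2%N -> cox_m s t2 = Some 2%N ->
  odd_label (cox_m t1 t2) -> rel_class s t1 = rel_class s t2.
Proof.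
move=> st1 st2; case t12: (cox_m t1 t2) => [k|//] ok.
apply: kin_inj; rewrite !rel_class_commute //.
have c1 := commute_sym (commute_gen st1); have c2 := commute_sym (commute_gen st2).
apply: (@commg_conj_central _ _ (@ext_proj _ _ _) (@ext_ker_central _ _ _)
  _ _ _ ((lift t1 * lift t2) ^+ uphalf k)%g).
- rewrite gmulfXn gmulfM; apply: odd_dihedral_conj (gen2 _) (gen2 _) ok _.
  exact: gen_power.
- exact: c1.
- rewrite gmulfXn gmulfM; apply/commute_sym/commuteX/commuteM; exact: commute_sym.
Qed.

Lemma ext_d2_lift s : ext_d2 (lift s) = << gen W s >>.
Proof. by rewrite /ext_d2 raddf0 add0r. Qed.

Lemma sq_class_d2 s : coker_d2 (sq_class s) = << gen W s >> + << gen W s >>.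
Proof. by rewrite -ext_d2_in sq_classE ext_d2M ext_d2_lift. Qed.

Lemma rel_class_d2 s t : coker_d2 (rel_class s t) =
  if odd_label (cox_m s t) then << gen W s >> + << gen W t >> else 0.
Proof.
case mst: (cox_m s t) => [k|]; last by rewrite /rel_class mst raddf0.
have := congr1 (@ext_d2 C) (rel_classE mst).
rewrite ext_d2_in ext_d2X ext_d2M !ext_d2_lift raddfD raddfMn raddfD /= !sq_class_d2.
rewrite addrACA -mulr2n -mulrnA mul2n; set x := _ + << gen W t >> => e.
apply: (addIr (x *+ k./2.*2)); rewrite e.
by rewrite -{1}(odd_double_half k) mulrnDr; case: odd.
Qed.
End CoxeterClasses.

(** The homomorphism Phi provided by [central_lift_functional] maps the power of the
    lifted product of s and t to the power of its action, which is a sign; the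
    correction by squares does not count because generators act as involutions. *)
Lemma twisted_functional (W : coxeter_system) (A : twisted_action W) :
  (exists m, @tw_flip _ A m <> m) ->
  exists v : {additive bar_coker (coxeter_group W) -> 'Z_2},
    (forall s, v (sq_class s) = 0) /\
    (forall s t, s != t -> cox_m s t != None ->
       v (rel_class s t) = (tw_sign A s t)%:R).
Proof.
case=> m flip_m; have z1 : tw_center A != 1%g.
  by apply/eqP => /(congr1 (fun f : eqperm (@tw_flip _ A) => f m)).
have [v [Phi [Phi_gen Phi_in]]] := central_lift_functional (tw_center2 A) z1
  (@tw_center_central W A) (@tw_perm_relator W A) (@gen_inj W).
exists v; have v_sq s : v (sq_class s) = 0.
  apply: (expg_Z2_inj z1); rewrite -Phi_in sq_classE gmulfM !Phi_gen.
  by rewrite tw_perm2.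
split=> // s t st; case mst: (cox_m s t) => [k|//] _.
have <- : v (rel_class s t + (sq_class s + sq_class t) *+ k./2) = v (rel_class s t).
  by rewrite raddfD raddfMn raddfD /= !v_sq addr0 mul0rn addr0.
apply: (expg_Z2_inj z1); rewrite -Phi_in (rel_classE mst) gmulfXn gmulfM !Phi_gen.
by rewrite (tw_perm_power A st mst); case: tw_sign.
Qed.

(** * The relations between the classes *)

(** Naming the projection keeps a single instance of the subtype structure in the
    statements below. *)
Definition edge_set (D : graph) (e : edge D) : {set vert D} := val e.

Lemma edge_set_inj (D : graph) : injective (@edge_set D).
Proof. exact: val_inj. Qed.

Definition pair_set (W : coxeter_system) (A : commuting_pair W) : {set cox_gen W} :=
  val A.

Section Lattice.
Variable W : coxeter_system.
Local Notation S := (cox_gen W).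
Local Notation C := (coxeter_group W).
Local Notation M := (bar_coker C).
Local Notation freeZ K := {freeg K / int}.
Local Notation V := (commuting_pair W).
Local Notation Eeven := (edge (D_even W)).
Local Notation Eodd := (edge (D_odd W)).

Lemma pair_setP (A : V) :
  exists s t, cox_m s t = Some 2%N /\ pair_set A = [set s; t].
Proof.
by case/existsP: (valP A) => s /existsP[t /andP[/eqP st /eqP e]]; exists s, t.
Qed.

Lemma edge_setP (D : graph) (e : edge D) :
  exists x y, adj x y /\ edge_set e = [set x; y].
Proof.
by case/existsP: (valP e) => s /existsP[t /andP[st /eqP h]]; exists s, t.
Qed.

(** Indexing by sets rather than ordered pairs is harmless by [rel_class_sym]. *)
Definition set_class (A : {set S}) : M :=
  if [pick p : S * S | (p.1 != p.2) && (A == [set p.1; p.2])] is Some p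
  then rel_class p.1 p.2 else 0.

Lemma set_classE (s t : S) : s != t -> set_class [set s; t] = rel_class s t.
Proof.
move=> st; rewrite /set_class; case: pickP => [[c d] /= /andP[cd /eqP e]|/(_ (s, t))].
  by case: (eq_set2 st e) => -[-> ->] //; rewrite rel_class_sym.
by rewrite /= st eqxx.
Qed.

(** Integral coefficients for the squares, the commuting pairs, the even edges and the
    odd edges, in this order.  The last three are to be reduced modulo two. *)
Definition lattice : zmodType :=
  (freeZ S * freeZ V * freeZ Eeven * freeZ Eodd)%type.

Definition lattice_class (x : lattice) : M :=
  zlift (@sq_class W) x.1.1.1 + zlift (fun A : V => set_class (pair_set A)) x.1.1.2
  + zlift (fun e : Eeven => set_class (edge_set e)) x.1.2
  + zlift (fun e : Eodd => set_class (edge_set e)) x.2.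

Fact lattice_class_additive : zmod_morphism lattice_class.
Proof.
move=> [[[a b] c] d] [[[a' b'] c'] d']; rewrite /lattice_class /= !raddfB.
rewrite !opprD [RHS]addrACA; congr (_ + _); rewrite [RHS]addrACA; congr (_ + _).
by rewrite [RHS]addrACA.
Qed.
HB.instance Definition _ :=
  GRing.isZmodMorphism.Build lattice M lattice_class lattice_class_additive.

Definition edge_ends : freeZ Eodd -> freeZ S :=
  zlift (fun e : Eodd => \sum_(s in edge_set e) << s >>).
HB.instance Definition _ := GRing.Additive.on edge_ends.

(** The boundary expressed through generators; squares have boundary 2[s]. *)
Definition lattice_ends (x : lattice) : freeZ S := x.1.1.1 + x.1.1.1 + edge_ends x.2.

Lemma edge_ends_red k : red2 (edge_ends k) = graph_d1 (red2 k).
Proof.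
move: k; apply: (eq_freegZ (f := @red2 _ \o edge_ends)
  (g := @graph_d1 (D_odd W) \o @red2 _)) => e /=.
rewrite /edge_ends zliftU red2U raddf_sum /= /graph_d1 fgliftU1.
by apply: eq_bigr => s _; rewrite red2U.
Qed.

Lemma lattice_class_d2 x :
  coker_d2 (lattice_class x) =
  fgpush (pres_gen (@coxeter_relator W)) (lattice_ends x).
Proof.
case: x => [[[a b] c] d]; rewrite /lattice_class /lattice_ends /=.
rewrite !(raddfD (@coker_d2 C)) !(raddfD (fgpush _)) /= !zlift_comp.
rewrite [X in _ + X + _ + _](eq_zlift (g := fun=> 0)) => [|A /=]; last first.
  have [s [t [st ->]]] := pair_setP A.
  by rewrite /= set_classE ?commuting_neq // rel_class_d2 st.
rewrite [X in _ + X + _](eq_zlift (g := fun=> 0)) => [|e /=]; last first.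
  have [s [t [/and3P[st est _] ->]]] := edge_setP e.
  rewrite /= set_classE // rel_class_d2.
  by case: (cox_m s t) est => //= k /negPf->.
rewrite !zlift0 !addr0; congr (_ + _).
  by rewrite fgpushE -zliftD; apply: eq_zlift => s; apply: sq_class_d2.
apply: eq_zlift => e /=.
have [s [t [/andP[st o] ->]]] := edge_setP e; rewrite set_classE // rel_class_d2 o.
by rewrite big_setU1 ?inE // big_set1 raddfD /= !fgpushU1.
Qed.

Lemma set_class_pair2 (A : V) : set_class (pair_set A) + set_class (pair_set A) = 0.
Proof.
have [s [t [st ->]]] := pair_setP A.
by rewrite set_classE ?commuting_neq // rel_class_double st.
Qed.

Lemma set_class_even2 (e : Eeven) :
  set_class (edge_set e) + set_class (edge_set e) = 0.
Proof.
have [s [t [/and3P[st est _] ->]]] := edge_setP e.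
rewrite set_classE // rel_class_double.
by case: (cox_m s t) est => //= k /negPf->.
Qed.

Lemma set_class_odd2 (e : Eodd) :
  set_class (edge_set e) + set_class (edge_set e) = \sum_(s in edge_set e) sq_class s.
Proof.
have [s [t [/andP[st o] ->]]] := edge_setP e; rewrite set_classE // rel_class_double o.
by rewrite big_setU1 ?inE // big_set1.
Qed.

Lemma set_class_bullet (A B : V) :
  bullet_adj A B -> set_class (pair_set A) = set_class (pair_set B).
Proof.
case/andP=> AB /existsP[s /existsP[t1 /existsP[t2 /and3P[/eqP eA /eqP eB o]]]].
have eA' : pair_set A = [set s; t1] := eA.
have eB' : pair_set B = [set s; t2] := eB.
have pair (D : V) t : pair_set D = [set s; t] -> cox_m s t = Some 2%N.
  have [s' [t' [st' ->]]] := pair_setP D.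
  by case/(eq_set2 (commuting_neq st')) => -[-> ->] //; rewrite cox_m_sym.
have st1 := pair _ _ eA'; have st2 := pair _ _ eB'.
by rewrite eA' eB' !set_classE ?commuting_neq //; apply: rel_class_bullet.
Qed.

(** Vanishing reductions make all coefficients even, up to a boundary on commuting
    pairs.  Doubled classes of pairs and even edges vanish, and doubled classes of
    odd edges are sums of squares; the squares then cancel because their boundary,
    twice the coefficient, does. *)
Lemma lattice_class_eq0 (x : lattice) : lattice_ends x = 0 ->
    (exists w, @graph_d1 (D_bullet W) w = red2 x.1.1.2) ->
    red2 x.1.2 = 0 -> red2 x.2 = 0 ->
  lattice_class x = 0.
Proof.
case: x => [[[a b] c] d]; rewrite /lattice_ends /= => ad [w wb].
move=> /red2_eq0[c' ec] /red2_eq0[d' ed].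
rewrite /lattice_class /= ec (zlift_double _ set_class_even2) addr0.
have -> : zlift (fun A : V => set_class (pair_set A)) b = 0.
  have [w' ew] := red2_surj w.
  (* an integral lift of the boundary map of the graph of commuting pairs *)
  pose bd : freeZ (edge (D_bullet W)) -> freeZ V :=
    zlift (fun e => \sum_(A in edge_set e) << A >>).
  have bd_red k : red2 (bd k) = graph_d1 (red2 k).
    move: k; apply: (eq_freegZ (f := @red2 _ \o zlift _)
      (g := @graph_d1 (D_bullet W) \o @red2 _)) => e /=.
    rewrite zliftU red2U raddf_sum /= /graph_d1 fgliftU1.
    by apply: eq_bigr => s _; rewrite red2U.
  have [b' eb] : exists b', b - bd w' = b' + b'.
    by apply: red2_eq0; rewrite raddfB /= bd_red ew wb subrr.
  rewrite -(subrK (bd w') b) eb raddfD /= (zlift_double _ set_class_pair2) add0r.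
  rewrite /bd zlift_comp (eq_zlift (g := fun=> 0)) ?zlift0 // => e /=.
  have [A [B [AB ->]]] := edge_setP e.
  have ADB : A != B by case/andP: AB.
  rewrite big_setU1 ?inE // big_set1 raddfD /= !zliftU.
  by rewrite -(set_class_bullet AB) set_class_pair2.
pose sq_ends (e : Eodd) := \sum_(s in edge_set e) sq_class s.
rewrite addr0 ed raddfD -zliftD (eq_zlift (g := sq_ends)); last exact: set_class_odd2.
have -> : zlift sq_ends d' = zlift (@sq_class W) (edge_ends d').
  rewrite /edge_ends zlift_comp; apply: eq_zlift => e /=.
  by rewrite raddf_sum; apply: eq_bigr => s _; rewrite /= zliftU.
rewrite -raddfD; suff -> : a + edge_ends d' = 0 by rewrite raddf0.
move: ad; rewrite ed raddfD /= addrACA => /eqP.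
move: (a + _) => n /eqP nn; apply/eqP/freeg_eqP => s.
by have := congr1 (coeff s) nn; rewrite coeffD coeff0; lia.
Qed.
End Lattice.

(** * Independence of the classes *)

Section Detection.
Variable W : coxeter_system.
Local Notation S := (cox_gen W).
Local Notation M := (bar_coker (coxeter_group W)).

Lemma functional_lattice_class (v : {additive M -> 'Z_2}) x :
  (forall s, v (sq_class s) = 0) ->
  v (lattice_class x) =
    zlift (fun A => v (set_class (pair_set A))) x.1.1.2
    + zlift (fun e : edge (D_even W) => v (set_class (edge_set e))) x.1.2
    + zlift (fun e : edge (D_odd W) => v (set_class (edge_set e))) x.2.
Proof.
move=> v0; rewrite /lattice_class !(raddfD v) /= !zlift_comp.
by rewrite (eq_zlift (f := v \o @sq_class W) (g := fun=> 0)) ?zlift0 ?add0r // => s.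
Qed.

Lemma is_commuting_pairE (s t : S) : s != t ->
  @is_commuting_pair W [set s; t] = (cox_m s t == Some 2%N).
Proof.
move=> st; apply/idP/idP => [|/eqP mst]; last exact: commuting_is_pair.
case/existsP=> s' /existsP[t' /andP[/eqP mst /eqP e]].
by case: (eq_set2 st e) mst => -[-> ->] <-; rewrite // cox_m_sym.
Qed.

Lemma clifford_flip (eps : {set S} -> bool) eps2 :
  exists m, @tw_flip _ (@clifford_action W eps eps2) m <> m.
Proof.
exists ([ffun=> 1] : clifford_module (S * bool)%type) => /ffunP/(_ [ffun=> false]).
rewrite !ffunE => /eqP; rewrite -subr_eq0 -opprD oppr_eq0 -mulr2n.
by rewrite pnatr_eq0.
Qed.

(** The two Clifford actions have signs which differ at A0 only; the signs forced on
    commuting pairs cancel in the difference of the functionals. *)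
Lemma edge_functional (A0 : {set S}) : ~~ @is_commuting_pair W A0 ->
  exists v : {additive M -> 'Z_2}, (forall s, v (sq_class s) = 0) /\
   (forall s t, s != t -> cox_m s t != None ->
     v (rel_class s t) = ([set s; t] == A0)%:R).
Proof.
pose eps A := (A == A0) || @is_commuting_pair W A.
move=> nA0; have e1 s t : cox_m s t = Some 2%N -> eps [set s; t].
  by move=> st; rewrite /eps is_commuting_pairE ?st ?orbT // commuting_neq.
have e2 s t : cox_m s t = Some 2%N -> @is_commuting_pair W [set s; t].
  by move=> st; rewrite is_commuting_pairE ?st // commuting_neq.
have [v1 [v1s v1r]] := twisted_functional (@clifford_flip eps e1).
have [v2 [v2s v2r]] := twisted_functional (@clifford_flip (@is_commuting_pair W) e2).
exists (v1 \- v2); split=> [s|s t st mst] /=.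
  by rewrite v1s v2s subrr.
rewrite v1r ?v2r //= /eps; case: eqP => [->|_] /=; last by rewrite subrr.
by rewrite (negPf nA0) subr0.
Qed.

Lemma coeff_edge (D : graph) (e0 : edge D) k :
  zlift (fun e : edge D => (edge_set e == edge_set e0)%:R : 'Z_2) k = coeff e0 (red2 k).
Proof.
move: k; apply: (eq_freegZ (g := coeff e0 \o @red2 _)) => e /=.
by rewrite zliftU red2U coeffU mul1r (inj_eq (@edge_set_inj D)).
Qed.

Lemma lattice_class_edges (x : lattice W) : lattice_class x = 0 ->
  red2 x.1.2 = 0 /\ red2 x.2 = 0.
Proof.
move=> x0; have key A0 : ~~ @is_commuting_pair W A0 ->
    zlift (fun e : edge (D_even W) => (edge_set e == A0)%:R : 'Z_2) x.1.2
    + zlift (fun e : edge (D_odd W) => (edge_set e == A0)%:R : 'Z_2) x.2 = 0.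
  move=> nA0; have [v [vs vr]] := edge_functional nA0.
  have := functional_lattice_class x vs; rewrite x0 raddf0.
  rewrite [X in _ = X + _ + _](eq_zlift (g := fun=> 0)) => [|A]; last first.
    have [s [t [st eA]]] := pair_setP A.
    rewrite eA set_classE ?commuting_neq //.
    rewrite vr ?st ?commuting_neq //; case: eqP => // e.
    by move: nA0; rewrite -e is_commuting_pairE ?st ?commuting_neq.
  rewrite zlift0 add0r => ->; congr (_ + _); apply: eq_zlift => e.
    have [s [t [/and3P[st est _] ->]]] := edge_setP e; rewrite set_classE // vr //.
    by case: (cox_m s t) est.
  have [s [t [/andP[st o] ->]]] := edge_setP e; rewrite set_classE // vr //.
  by case: (cox_m s t) o.
have even_odd (e : edge (D_even W)) (f : edge (D_odd W)) : edge_set e != edge_set f.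
  have [s [t [/and3P[st est _] ->]]] := edge_setP e.
  have [s' [t' [/andP[_ o] ->]]] := edge_setP f.
  apply/eqP => /(eq_set2 st) h; have : cox_m s' t' = cox_m s t.
    by case: h => -[-> ->]; rewrite // cox_m_sym.
  by move=> m'; move: est o; rewrite m'; case: (cox_m s t) => //= k /negPf->.
split; apply/eqP/freeg_eqP => e; rewrite coeff0 -coeff_edge.
  rewrite -[RHS](key (edge_set e)); last first.
    have [s [t [/and3P[st _ n2] ->]]] := edge_setP e.
    by rewrite is_commuting_pairE.
  rewrite [X in _ = _ + X](eq_zlift (g := fun=> 0)) ?zlift0 ?addr0 // => f.
  by rewrite eq_sym (negPf (even_odd _ _)).
rewrite -[RHS](key (edge_set e)); last first.
  have [s [t [/andP[st o] ->]]] := edge_setP e; rewrite is_commuting_pairE //.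
  by apply/eqP => m2; rewrite m2 in o.
rewrite [X in _ = X + _](eq_zlift (g := fun=> 0)) ?zlift0 ?add0r // => f.
by rewrite (negPf (even_odd _ _)).
Qed.

(** The coefficients at the edges, where the values of the functional of a component
    action are unspecified, are even by [lattice_class_edges]. *)
Lemma lattice_class_pairs (x : lattice W) : lattice_class x = 0 ->
  exists w, @graph_d1 (D_bullet W) w = red2 x.1.1.2.
Proof.
move=> x0; have [c0 d0] := lattice_class_edges x0.
apply: boundary_of_component_sums => A0.
have [v [vs vr]] := twisted_functional (component_action_flip A0).
have := functional_lattice_class x vs; rewrite x0 raddf0.
rewrite (zlift_red2 _ c0) (zlift_red2 _ d0) !addr0 => /esym e; rewrite -[RHS]e.
move: (x.1.1.2); apply: (eq_freegZ (f := component_sum A0 \o @red2 _)) => A /=.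
rewrite red2U component_sumU mul1r zliftU.
have [s [t [st eA]]] := pair_setP A.
rewrite eA set_classE ?commuting_neq // vr ?st ?commuting_neq //.
rewrite (component_action_sign _ st); congr (connect _ _ _)%:R.
by apply: val_inj; rewrite SubK.
Qed.

(** The coefficients of the squares are chosen so as to cancel the boundary of the odd
    edges, which is even. *)
Lemma lattice_red_surj (b : {freeg (vert (D_bullet W)) / 'Z_2})
    (c : {freeg (edge (D_even W)) / 'Z_2}) (d : {freeg (edge (D_odd W)) / 'Z_2}) :
  graph_d1 d = 0 -> exists x : lattice W,
    [/\ lattice_ends x = 0, red2 x.1.1.2 = b, red2 x.1.2 = c & red2 x.2 = d].
Proof.
move=> d0; have [b' eb] := red2_surj b; have [c' ec] := red2_surj c.
have [d' ed] := red2_surj d.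
have /red2_eq0[n en] : red2 (edge_ends d') = 0 by rewrite edge_ends_red ed.
exists (- n, b', c', d'); split=> //=.
by rewrite /lattice_ends /= en addrACA addNr addr0.
Qed.
End Detection.

(** * Generation and naturality *)

Section Generation.
Variable W : coxeter_system.
Local Notation S := (cox_gen W).
Local Notation C := (coxeter_group W).
Local Notation M := (bar_coker C).
Local Notation lift := (@ext_gen S (@coxeter_relator W)).
Local Notation kin := (ext_in (bar_cocycle C)).

Lemma sq_class_lattice s : exists x : lattice W, lattice_class x = sq_class s.
Proof.
by exists (<< s >>, 0, 0, 0); rewrite /lattice_class /= !raddf0 zliftU !addr0.
Qed.

Lemma rel_class_lattice s t : s != t -> cox_m s t != None ->
  exists x : lattice W, lattice_class x = rel_class s t.
Proof.
move=> st; case mst: (cox_m s t) => [k|//] _.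
have [ok|ek] := boolP (odd k).
  have o : odd_adj s t by rewrite /odd_adj st mst.
  exists (0, 0, 0, << Sub _ (@adj_is_edge (D_odd W) _ _ o) >>).
  by rewrite /lattice_class /= !raddf0 zliftU !add0r /edge_set SubK set_classE.
have [k2|k2] := eqVneq k 2%N.
  rewrite k2 in mst; exists (0, << Sub _ (commuting_is_pair mst) >>, 0, 0).
  rewrite /lattice_class /= !raddf0 zliftU !(add0r, addr0) /pair_set.
  by rewrite SubK set_classE.
have e : even_adj s t by rewrite /even_adj st mst /= ek; apply: contra k2 => /eqP[->].
exists (0, 0, << Sub _ (@adj_is_edge (D_even W) _ _ e) >>, 0).
by rewrite /lattice_class /= !raddf0 zliftU !(add0r, addr0) /edge_set SubK set_classE.
Qed.

Lemma relator_lattice r : coxeter_relator r ->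
  exists x : lattice W, word_eval lift r = kin (lattice_class x).
Proof.
case=> s [t [k [mst ->]]]; rewrite word_eval_alternating.
have [st|st] := eqVneq s t.
  have [x ex] := sq_class_lattice s; exists x.
  by move: mst; rewrite ex -st cox_m_diag => -[<-]; rewrite expg1 sq_classE.
have [|x ex] := @rel_class_lattice s t st; first by rewrite mst.
have [a ea] := sq_class_lattice s; have [b eb] := sq_class_lattice t.
exists (x + (a + b) *+ k./2).
by rewrite raddfD raddfMn raddfD /= ex ea eb (rel_classE mst).
Qed.

Lemma section_lattice (w1 w2 : seq (S * bool)) : \pi_C w1 = \pi_C w2 ->
  exists x : lattice W,
    word_eval lift w1 = (word_eval lift w2 * kin (lattice_class x))%g.
Proof.
move=> /presented_eqP w12.
have [g [x ->] ->] : exists2 g, (exists x : lattice W, g = kin (lattice_class x))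
    & word_eval lift w1 = (word_eval lift w2 * g)%g; last by exists x.
apply: (word_eval_eq_central _ _ _ _ _ w12).
- by exists 0; rewrite raddf0 ext_in0.
- by move=> _ _ [x ->] [y ->]; exists (x + y); rewrite raddfD; apply/esym/ext_inD.
- by move=> _ [x ->]; exists (- x); rewrite raddfN; apply/esym/ext_inV.
- by move=> _ [x ->]; apply: ext_ker_central.
- exact: relator_lattice.
Qed.

(** Let s(g) = (g, u(g)) be the lift of g given by a word for it.  The defect of s
    from being a homomorphism lies in the span of the classes, so [g|h] agrees
    modulo this span with the coboundary of - u, which vanishes on cycles. *)
Lemma bar_class_lattice z : bar_d2 z = 0 ->
  exists x : lattice W, lattice_class x = bar_class z.
Proof.
move=> dz; pose s (g : C) := word_eval lift (repr g).
have s1 g : (s g).1 = g.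
  rewrite -[LHS]/(ext_proj (s g)) /s word_eval_morph -[RHS]reprK -[RHS]word_eval_gen.
  by apply: eq_bigr.
pose u g : M := (s g).2.
have key g h : exists x : lattice W,
    lattice_class x = bar_cocycle_fun g h + (u h - u (g * h)%g + u g).
  have [|x] := @section_lattice (repr g ++ repr h) (repr (g * h)%g).
    by rewrite -pres_mul_pi !reprK.
  rewrite word_eval_cat -!/(s _) => /(congr1 snd) e.
  have {e} : u g + u h + bar_cocycle C (s g).1 (s h).1 =
      u (g * h)%g + (lattice_class x - bar_cocycle C 1%g 1%g)
      + bar_cocycle C (s (g * h)%g).1 1%g := e.
  rewrite !s1 (cocycleg1 (bar_cocycle C)) addrA subrK => e; exists x.
  apply: (addrI (u (g * h)%g)); rewrite -e.
  rewrite [RHS]addrCA [u _ + (_ + _)]addrC (addrAC (u h)) subrK addrC.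
  by rewrite (addrC (u g)).
pose X (p : C * C) : lattice W := projT1 (cid (key p.1 p.2)).
have XP p : lattice_class (X p) = _ := projT2 (cid (key p.1 p.2)).
exists (zlift X z).
transitivity (bar_class z + zlift u (bar_d2 z)); last by rewrite dz raddf0 addr0.
move: {dz} z; apply: (eq_freegZ (f := @lattice_class W \o zlift X)
  (g := @bar_class C \+ (zlift u \o @bar_d2 C))) => -[g h] /=.
rewrite zliftU XP /= /bar_d2 fgliftU1; congr (_ + _).
by rewrite raddfD raddfB /= !zliftU.
Qed.

Lemma lattice_ends_H2 (x : lattice W) (h : H2 C) :
  lattice_class x = H2_coker h -> lattice_ends x = 0.
Proof.
move=> ex; apply/eqP/freeg_eqP => s; rewrite coeff0.
have := lattice_class_d2 x; rewrite ex H2_coker_d2 => /(congr1 (coeff (gen W s))).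
rewrite coeff0 => ->.
move: (lattice_ends x); apply: (@eq_freeg_additive int S int (coeff s)
  (coeff (gen W s) \o fgpush (pres_gen (@coxeter_relator W)))) => k t /=.
by rewrite /fgpush liftU freegZU mulr1 !coeffU (inj_eq (@gen_inj W)).
Qed.

Lemma H2_lattice (h : H2 C) : exists x : lattice W, lattice_class x = H2_coker h.
Proof. by apply: bar_class_lattice; apply/eqP; exact: (valP (repr h)). Qed.
End Generation.

Section Naturality.
Variables (G K : groupType) (f : {multiplicative G -> K}).

Fact coker_map_d3 a : (@bar_class K \o bar_map2 f) (bar_d3 a) = 0.
Proof. by rewrite /= bar_map_d3 bar_class_d3. Qed.
Definition coker_map : bar_coker G -> bar_coker K :=
  coker_lift (@bar_class K \o bar_map2 f).
HB.instance Definition _ :=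
  GRing.isZmodMorphism.Build _ _ coker_map (coker_lift_additive coker_map_d3).

Lemma coker_mapE z : coker_map (bar_class z) = bar_class (bar_map2 f z).
Proof. exact: coker_liftE coker_map_d3 z. Qed.

Lemma coker_map_H2 x : coker_map (H2_coker x) = H2_coker (H2_map f x).
Proof.
by rewrite -[x]reprK H2_cokerE coker_mapE /H2_map homology_map_pi H2_cokerE.
Qed.

Definition ext_map (e : cocycle_ext (bar_cocycle G)) : cocycle_ext (bar_cocycle K) :=
  (f e.1, coker_map e.2).

Fact ext_mapM : {morph ext_map : e h / (e * h)%g}.
Proof.
move=> [g x] [h y]; rewrite !ext_mulE /ext_map /= gmulfM !raddfD /=; congr (_, _ + _).
by rewrite coker_mapE /bar_map2 fgpushU1.
Qed.

Fact ext_map1 : ext_map 1%g = 1%g.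
Proof. by apply: (mulgI (ext_map 1%g)); rewrite -ext_mapM !mulg1. Qed.
HB.instance Definition _ := isMultiplicative.Build _ _ ext_map ext_mapM.
HB.instance Definition _ :=
  Multiplicative_isUMagmaMorphism.Build _ _ ext_map ext_map1.

Lemma ext_val_map e : ext_val (ext_map e) = coker_map (ext_val e).
Proof.
rewrite /ext_val raddfD /=; congr (_ + _).
have f1 : f 1%g = 1%g by apply: (mulgI (f 1%g)); rewrite -gmulfM !mulg1.
by rewrite /bar_cocycle_fun coker_mapE /bar_map2 fgpushU1 /= f1.
Qed.
End Naturality.

Section CoxeterNaturality.
Variables (U W : coxeter_system) (i : full_inclusion U W).
Local Notation c_map := (coker_map (coxeter_map i)).

Lemma ext_map_gen s : ext_map (coxeter_map i) (ext_gen (@coxeter_relator U) s) =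
  ext_gen (@coxeter_relator W) (i s).
Proof. by rewrite /ext_map /ext_gen /= coxeter_map_gen raddf0. Qed.

Lemma sq_class_map s : c_map (sq_class s) = sq_class (i s).
Proof. by rewrite /sq_class -ext_val_map gmulfM /= !ext_map_gen. Qed.

Lemma rel_class_map s t : c_map (rel_class s t) = rel_class (i s) (i t).
Proof.
rewrite /rel_class incl_m; case: cox_m => [k|]; last by rewrite raddf0.
rewrite (raddfB c_map) (raddfMn c_map) (raddfD c_map (sq_class s)) /= !sq_class_map.
by rewrite -ext_val_map gmulfXn gmulfM /= !ext_map_gen.
Qed.

Lemma set_class_map (A : {set cox_gen U}) : c_map (set_class A) = set_class (i @: A).
Proof.
rewrite {1}/set_class; case: pickP => [[s t] /= /andP[st /eqP ->]|nA].
  rewrite imsetU !imset_set1 set_classE ?(inj_eq (@incl_inj _ _ i)) //.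
  exact: rel_class_map.
rewrite raddf0 /set_class; case: pickP => // -[s t] /= /andP[st /eqP e].
have in_im x : x \in [set s; t] -> exists2 y, y \in A & x = i y.
  by rewrite -e => /imsetP.
have [[a aA ea] [b bA eb]] := (in_im s (set21 _ _), in_im t (set22 _ _)).
have /= := nA (a, b); rewrite -(inj_eq (@incl_inj _ _ i)) -ea -eb st => /eqP[].
by apply: (imset_inj (@incl_inj _ _ i)); rewrite e imsetU !imset_set1 ea eb.
Qed.

Definition lattice_map (x : lattice U) : lattice W :=
  (fgpush i x.1.1.1, fgpush (pair_map i) x.1.1.2,
   fgpush (edge_map (D_even_incl i)) x.1.2, fgpush (edge_map (D_odd_incl i)) x.2).

Lemma lattice_class_map x : lattice_class (lattice_map x) = c_map (lattice_class x).
Proof.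
rewrite /lattice_class !(raddfD c_map) /= !zlift_comp !zlift_push.
congr (_ + _ + _ + _); apply: eq_zlift => A /=.
- by rewrite sq_class_map.
- by rewrite set_class_map.
- by rewrite set_class_map.
- by rewrite set_class_map.
Qed.
End CoxeterNaturality.

(** * The comparison isomorphism *)

Section Comparison.
Variable W : coxeter_system.

Definition diagram_chains : zmodType :=
  (graph_H0 (D_bullet W) * {freeg (edge (D_even W)) / 'Z_2}
    * {freeg (edge (D_odd W)) / 'Z_2})%type.

Definition lattice_diagram (x : lattice W) : diagram_chains :=
  (H0_class (red2 x.1.1.2 : {freeg (vert (D_bullet W)) / 'Z_2}),
   red2 x.1.2, red2 x.2).

Fact lattice_diagram_additive : zmod_morphism lattice_diagram.
Proof. by move=> x y; rewrite /lattice_diagram /= !raddfB. Qed.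
HB.instance Definition _ :=
  GRing.isZmodMorphism.Build (lattice W) diagram_chains lattice_diagram
    lattice_diagram_additive.

Definition diagram_sum_chains (d : diagram_sum W) : diagram_chains :=
  (d.1.1, d.1.2, H1_chain d.2).

Fact diagram_sum_chains_additive : zmod_morphism diagram_sum_chains.
Proof. by move=> x y; rewrite /diagram_sum_chains /= !raddfB. Qed.
HB.instance Definition _ :=
  GRing.isZmodMorphism.Build (diagram_sum W) diagram_chains diagram_sum_chains
    diagram_sum_chains_additive.

Lemma diagram_sum_chains_inj : injective diagram_sum_chains.
Proof. by case=> [[a b] c] [[a' b'] c'] [-> -> /H1_chain_inj ->]. Qed.

Lemma lattice_diagram_cycle x : lattice_ends x = 0 -> exists d : diagram_sum W,
  lattice_diagram x = diagram_sum_chains d.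
Proof.
move=> x0; have [h eh] : exists h : graph_H1 (D_odd W), H1_chain h = red2 x.2.
  apply: H1_chain_surj; rewrite -edge_ends_red; move: x0; rewrite /lattice_ends addrC.
  move/eqP; rewrite addr_eq0 => /eqP ->.
  by rewrite raddfN raddfD /= freeg2_double oppr0.
exists ((lattice_diagram x).1.1, (lattice_diagram x).1.2, h).
by rewrite /diagram_sum_chains /= eh.
Qed.

Lemma lattice_class_diagram x : lattice_class x = 0 -> lattice_diagram x = 0.
Proof.
move=> x0; have [c0 d0] := lattice_class_edges x0.
have /H0_class_eq0 b0 := lattice_class_pairs x0.
by rewrite /lattice_diagram b0 c0 d0.
Qed.

Lemma diagram_lattice_class x : lattice_ends x = 0 -> lattice_diagram x = 0 ->
  lattice_class x = 0.
Proof.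
by move=> x0 [/H0_class_eq0 b0 c0 d0]; apply: lattice_class_eq0.
Qed.

Lemma comparison : exists phi : {additive cox_H2 W -> diagram_sum W},
  bijective phi /\
  forall x h, lattice_class x = H2_coker h ->
    lattice_diagram x = diagram_sum_chains (phi h).
Proof.
apply: additive_correspondence.
- exact: H2_coker_inj.
- exact: diagram_sum_chains_inj.
- move=> h; have [x ex] := H2_lattice h.
  have [d ed] := lattice_diagram_cycle (lattice_ends_H2 ex).
  by exists x, d.
- case=> [[b c] d]; have [b' eb] := H0_class_surj b.
  have [x [x0 xb xc xd]] := lattice_red_surj b' c (H1_chain_d1 d).
  have [h eh] : exists h : cox_H2 W, H2_coker h = lattice_class x.
    by apply: H2_coker_image; rewrite lattice_class_d2 x0 raddf0.
  exists x, h; split=> //.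
  rewrite -eb; congr (_, _, _); [|exact: xc|exact: xd].
  by rewrite xb.
- exact: lattice_class_diagram.
- by move=> x h xh; apply: diagram_lattice_class; apply: lattice_ends_H2 xh.
Qed.
End Comparison.

Lemma lattice_diagram_map (U W : coxeter_system) (i : full_inclusion U W) x d :
  lattice_diagram x = diagram_sum_chains d ->
  lattice_diagram (lattice_map i x) = diagram_sum_chains (diagram_sum_map i d).
Proof.
case=> eb ec ed.
rewrite /lattice_diagram /diagram_sum_chains /= -eb -ec H1_chain_map -ed.
by rewrite H0_class_map /graph_map0 /graph_map1 !red2_push.
Qed.

Theorem theorem1 :
  exists phi : forall W : coxeter_system, {additive cox_H2 W -> diagram_sum W},
    (forall W : coxeter_system, bijective (phi W)) /\
    (forall (U W : coxeter_system) (i : full_inclusion U W) (x : cox_H2 U),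
       phi W (cox_H2_map i x) = diagram_sum_map i (phi U x)).
Proof.
exists (fun W => projT1 (cid (comparison W))); split=> [W|U W i h].
  by case: cid => phi [].
case: cid => phiW [_ natW] /=; case: cid => phiU [_ natU] /=.
have [x xh] := H2_lattice h; apply: diagram_sum_chains_inj.
rewrite -(lattice_diagram_map i (natU x h xh)); apply/esym/natW.
by rewrite lattice_class_map xh coker_map_H2.
Qed.
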